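(* Let $f_-$ and $f_+$ be two functions in $\mathcal{C}^1(\mathbb{R})$ such that $f_\pm'$ are Lipschitz continuous (and having finitely many inflection points), let $u^\epsilon, v^\epsilon\in L^\infty(\mathbb{R})\cap BV(\mathbb{R})$ be solutions of the self-similar viscous boundary value problem given in the context, and let $\mathcal{U}^\epsilon(y)=u^\epsilon(\epsilon y)$, $\mathcal{V}^\epsilon(y)=v^\epsilon(\epsilon y)$ be the rescaled functions. Then the following hold. (1) As $\epsilon\to0$, $\mathcal{V}^\epsilon$ converges uniformly to the bounded monotone increasing function $\mathcal{V}\in\mathcal{C}^\infty(\mathbb{R})$ given by $$\mathcal{V}(y)=-1+2\,\frac{\int_{-\infty}^y e^{-s^2/2}\,ds}{\int_{-\infty}^{+\infty} e^{-s^2/2}\,ds}.$$ More precisely, there is a constant $C>0$ independent of $\epsilon>0$ such that $\|\mathcal{V}^\epsilon-\mathcal{V}\|_{L^\infty(\mathbb{R})}\le C e^{-M^2/(2\epsilon^2)}$. (2) Up to a subsequence, $\mathcal{U}^\epsilon$ converges strongly in $L^1_{\mathrm{loc}}(\mathbb{R})$ to a bounded and monotone function $\mathcal{U}\in\mathcal{C}^2(\mathbb{R})$, whose monotonicity corresponds to the sign of $u_R-u_L$. The limit $\mathcal{U}$ is a solution of the viscous profile equation $$\tfrac12\left((1-\mathcal{V})f_-'(\mathcal{U})+(1+\mathcal{V})f_+'(\mathcal{U})\right)\mathcal{U}'=\mathcal{U}''$$ on $\mathbb{R}$, and it admits limits $\mathcal{U}_{-\infty}$ and $\mathcal{U}_{+\infty}$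 at $-\infty$ and $+\infty$, which satisfy $\min(u_L,u_R)\le \mathcal{U}_{\pm\infty}\le\max(u_L,u_R)$. (3) The inner profile is non trivial, i.e. $\mathcal{U}'(y)\ne0$ for all finite $y\in\mathbb{R}$ (and then necessarily $\mathcal{U}'(y)\to0$ as $|y|\to\infty$), if and only if the following two asymptotic conditions are fulfilled: $$\lim_{y\to+\infty}\int_0^y f_+'(\mathcal{U}(s))\,ds=-\infty,\qquad \lim_{y\to-\infty}\int_y^0 f_-'(\mathcal{U}(s))\,ds=+\infty.$$
   Context: Given $(u_L,u_R)\in\mathbb{R}^2$, $M>0$ is $M=\sup_{u}\left(|f_-'(u)|+|f_+'(u)|\right)$, the supremum being over the closed interval with endpoints $u_L,u_R$. For $\epsilon>0$, $(u^\epsilon,v^\epsilon)$ is a solution on $[-M,M]$ of $$-\xi \frac{du^\epsilon}{d\xi} + \tfrac12\left((1-v^\epsilon)f_-'(u^\epsilon)+(1+v^\epsilon) f_+'(u^\epsilon)\right)\frac{du^\epsilon}{d\xi} = \epsilon \frac{d^2u^\epsilon}{d\xi^2},\qquad -\xi \frac{dv^\epsilon}{d\xi} = \epsilon^2 \frac{d^2v^\epsilon}{d\xi^2},$$ with boundary conditions $u^\epsilon(-M)=u_L$, $u^\epsilon(M)=u_R$, $v^\epsilon(-M)=-1$, $v^\epsilon(M)=+1$. The rescaled functions $\mathcal{U}^\epsilon(y)=u^\epsilon(\epsilon y)$, $\mathcal{V}^\epsilon(y)=v^\epsilon(\epsilon y)$, defined for $\epsilon|y|\le M$, are extended to all of $\mathbb{R}$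 by the constant boundary values ($u_L$, $-1$ on the left and $u_R$, $+1$ on the right).
   Formalization: In (3) the equivalence is stated only for u_L ≠ u_R: if u_L = u_R = c with f_+'(c) < 0 < f_-'(c), then U is the constant c, so U' = 0 although both asymptotic conditions hold. *)

(* Defs.v *)
From Stdlib Require Import Reals List Lra.
From Coquelicot Require Import Coquelicot.
Open Scope R_scope.

Definition Ck (k : nat) (f : R -> R) : Prop :=
  forall (j : nat) (x : R), (j <= k)%nat ->
    ex_derive_n f j x /\ continuous (Derive_n f j) x.

Definition lipschitz (f : R -> R) : Prop :=
  exists K : R, forall x y : R, Rabs (f x - f y) <= K * Rabs (x - y).

Definition strictly_convex_on (a b : R) (f : R -> R) : Prop :=
  forall x y t : R, a <= x -> x < y -> y <= b -> 0 < t < 1 ->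
    f ((1 - t) * x + t * y) < (1 - t) * f x + t * f y.

Definition strictly_concave_on (a b : R) (f : R -> R) : Prop :=
  strictly_convex_on a b (fun x => - f x).

(* Convexity is strict on both sides, so an affine piece contributes no
   inflection points and affine functions are allowed below. *)
Definition inflection_point (f : R -> R) (x : R) : Prop :=
  exists d : R, 0 < d /\
    ((strictly_convex_on (x - d) x f /\ strictly_concave_on x (x + d) f) \/
     (strictly_concave_on (x - d) x f /\ strictly_convex_on x (x + d) f)).

Definition finitely_many_inflection_points (f : R -> R) : Prop :=
  exists l : list R, forall x : R, inflection_point f x -> In x l.

Definition flux (f : R -> R) : Prop :=
  Ck 1 f /\ lipschitz (Derive f) /\ finitely_many_inflection_points f.

Definition is_max_speed (fm fp : R -> R) (uL uR M : R) : Prop :=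
  is_lub (fun r => exists u : R, Rmin uL uR <= u <= Rmax uL uR /\
                     r = Rabs (Derive fm u) + Rabs (Derive fp u)) M.

(* [extend M l r w] is [w] on [-M,M], [l] to its left and [r] to its right. *)
Definition extend (M l r : R) (w : R -> R) (x : R) : R :=
  if Rlt_dec x (- M) then l else if Rlt_dec M x then r else w x.

Definition bounded_fun (f : R -> R) : Prop :=
  exists K : R, forall x : R, Rabs (f x) <= K.

(* BV(R) is finiteness of the total variation; integrability over R is not
   required, the functions at hand being nonzero constants near infinity. *)
Definition finite_variation (f : R -> R) : Prop :=
  exists K : R, forall (n : nat) (x : nat -> R),
    (forall i : nat, x i <= x (S i)) ->
    sum_f_R0 (fun i => Rabs (f (x (S i)) - f (x i))) n <= K.

Definition continuous_on_segment (a b : R) (w : R -> R) : Prop :=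
  forall x : R, a <= x <= b ->
    filterlim w (within (fun z => a <= z <= b) (locally x)) (locally (w x)).

Definition twice_derivable_at (w : R -> R) (x : R) : Prop :=
  ex_derive w x /\ ex_derive (Derive w) x.

(* Classical solutions: twice differentiable on (-M,M), continuous on [-M,M].
   Values of [u] and [v] outside [-M,M] are irrelevant. *)
Record is_viscous_solution
    (fm fp : R -> R) (uL uR M eps : R) (u v : R -> R) : Prop := {
  vs_u_cont : continuous_on_segment (- M) M u;
  vs_v_cont : continuous_on_segment (- M) M v;
  vs_u_derivable : forall xi : R, - M < xi < M -> twice_derivable_at u xi;
  vs_v_derivable : forall xi : R, - M < xi < M -> twice_derivable_at v xi;
  vs_u_eq : forall xi : R, - M < xi < M ->
    - xi * Derive u xi
    + / 2 * ((1 - v xi) * Derive fm (u xi) + (1 + v xi) * Derive fp (u xi))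
          * Derive u xi
    = eps * Derive_n u 2 xi;
  vs_v_eq : forall xi : R, - M < xi < M ->
    - xi * Derive v xi = eps ^ 2 * Derive_n v 2 xi;
  vs_u_left : u (- M) = uL;
  vs_u_right : u M = uR;
  vs_v_left : v (- M) = -1;
  vs_v_right : v M = 1;
  vs_u_bounded : bounded_fun (extend M uL uR u);
  vs_v_bounded : bounded_fun (extend M (-1) 1 v);
  vs_u_bv : finite_variation (extend M uL uR u);
  vs_v_bv : finite_variation (extend M (-1) 1 v)
}.

(* For [0 < eps] the thresholds [eps * y < -M] and [M < eps * y] are the bounds
   of the region [eps * |y| <= M]. *)
Definition rescaled (M l r eps : R) (w : R -> R) (y : R) : R :=
  extend M l r w (eps * y).

Definition gauss (s : R) : R := exp (- (s ^ 2 / 2)).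

Definition Vlim (y : R) : R :=
  -1 + 2 * (RInt_gen gauss (Rbar_locally m_infty) (at_point y)
            / RInt_gen gauss (Rbar_locally m_infty) (Rbar_locally p_infty)).

(* Riemann integrals suffice: this is only applied to continuous functions. *)
Definition L1loc_lim (w : nat -> R -> R) (W : R -> R) : Prop :=
  forall a b : R, a <= b ->
    (forall n : nat, ex_RInt (fun y => Rabs (w n y - W y)) a b) /\
    is_lim_seq (fun n => RInt (fun y => Rabs (w n y - W y)) a b) 0.

Definition vanishing (e : nat -> R) : Prop :=
  (forall n : nat, 0 < e n) /\ is_lim_seq e 0.

Definition extraction (phi : nat -> nat) : Prop :=
  forall n : nat, (phi n < phi (S n))%nat.

Definition nondecreasing (f : R -> R) : Prop :=
  forall x y : R, x <= y -> f x <= f y.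

Definition nonincreasing (f : R -> R) : Prop :=
  forall x y : R, x <= y -> f y <= f x.

Definition strictly_increasing (f : R -> R) : Prop :=
  forall x y : R, x < y -> f x < f y.

(* Main.v *)
Require Import Defs.
From Stdlib Require Import Reals List Lra Lia ClassicalEpsilon FunctionalExtensionality.
From Coquelicot Require Import Coquelicot.
Open Scope R_scope.

(** Both rescaled equations have the form [U'' = a U'] on [(-m, m)] with [m = M / eps]:
    the drift [a] is [-y] for the color function and [A - eps y] for the state, where
    [A = ((1 - V) fm'(U) + (1 + V) fp'(U)) / 2]. Hence the slope is a constant times
    the exponential of a primitive of the drift; it keeps one sign, and [U] is monotone between
    its boundary values. This common structure is the record [layer].

    For the color function the equation integrates to [V y = T y / T m], with [T] the Gaussian
    area from [0]; comparing with [T y / H], where [H] is the limit of [T], leaves an error of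
    at most the relative Gaussian tail [(H - T m) / H <= exp (- m ^ 2 / 2)]
    ([gaussian_layer_error]).

    For the state, monotonicity gives [|A| <= M], and [|eps y| <= M] inside the layer, so the
    drift is at most [2 M]; together with the mean value theorem this bounds the slope
    uniformly in [eps] ([layer_gradient_bound]). Two layers with close data
    [(U 0, U' 0)] stay close on compact sets, by Gronwall's inequality for the squared
    distance in the phase plane ([viscous_layer_stability]); this is where the Lipschitz
    continuity of [fm'] and [fp'] enters. Extracting a subsequence along which the two
    numbers [U 0] and [U' 0] converge therefore makes the whole profiles Cauchy, locally
    uniformly with their slopes, and the limit solves the limit equation
    ([viscous_layers_converge]).

    A limit profile satisfies [U' y = U' 0 * exp (the integral of A from 0 to y)], and
    [U'] tends to [0] at both ends because [U] has limits there. If [U' 0 <> 0] the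
    integral of [A] must tend to minus infinity at both ends; since [1 - V] is integrable on the
    right and [1 + V] on the left, the same holds with [fp'] and [fm'] in place of
    [A], which is the asymptotic condition ([nontrivial_profile_conditions]). Conversely, if
    [U'] vanishes somewhere, then [U] is a constant [u0], and the asymptotic condition reads
    [fp'(u0) < 0 < fm'(u0)]. The drift of the approximating layers then makes their slopes
    decay exponentially away from a fixed compact set as long as they stay near [u0];
    as their slopes on that compact set tend to [0], they never leave a neighbourhood of [u0]
    ([layer_trapped_right], [layer_trapped_left]), so both boundary values equal [u0]
    ([constant_limit_equal_states]), which [uL <> uR] excludes. *)

(** * Calculus on the line *)

Lemma mean_value (f df : R -> R) (a b : R) :
  a <= b ->
  (forall x, a < x < b -> is_derive f x (df x)) ->
  (forall x, a <= x <= b -> continuous f x) ->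
  exists c, a <= c <= b /\ f b - f a = df c * (b - a).
Proof.
intros Hab Hd Hc.
destruct (MVT_gen f a b df) as [c Hx]; rewrite ?Rmin_left, ?Rmax_right in * by lra.
- exact Hd.
- intros x Hx. apply continuity_pt_filterlim. now apply Hc.
- now exists c.
Qed.

Lemma is_derive_continuous (f : R -> R) (x l : R) :
  is_derive f x l -> continuous f x.
Proof.
intros H. apply (@ex_derive_continuous R_AbsRing R_NormedModule f x). now exists l.
Qed.

Lemma derive_nonneg_le (f df : R -> R) (a b : R) :
  a <= b ->
  (forall x, a < x < b -> is_derive f x (df x)) ->
  (forall x, a <= x <= b -> continuous f x) ->
  (forall x, a <= x <= b -> 0 <= df x) ->
  f a <= f b.
Proof.
intros Hab Hd Hc Hp.
destruct (mean_value f df a b Hab Hd Hc) as [c [Hc1 E]].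
specialize (Hp c Hc1). nra.
Qed.

Lemma derive_zero_eq (f : R -> R) (l r x y : R) :
  (forall z, l < z < r -> is_derive f z 0) ->
  l < x < r -> l < y < r -> f x = f y.
Proof.
intros Hd Hx Hy.
assert (W : forall x y, x <= y -> l < x < r -> l < y < r -> f x = f y).
{ intros p q Hpq Hp Hq.
  destruct (mean_value f (fun _ => 0) p q Hpq) as [c [_ E]].
  - intros z Hz. apply Hd. lra.
  - intros z Hz. apply (is_derive_continuous _ _ 0), Hd. lra.
  - lra. }
destruct (Rle_dec x y); [|symmetry]; apply W; lra.
Qed.

Lemma ex_RInt_cont (a : R -> R) (x y : R) :
  (forall z, continuous a z) -> ex_RInt a x y.
Proof.
intros H. apply (@ex_RInt_continuous R_CompleteNormedModule). intros z _. apply H.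
Qed.

Lemma is_derive_primitive (a : R -> R) (x y : R) :
  (forall z, continuous a z) -> is_derive (RInt a x) y (a y).
Proof.
intros H. apply (@is_derive_RInt R_NormedModule a (RInt a x) x y); [|apply H].
apply filter_forall. intros z.
apply (@RInt_correct R_CompleteNormedModule). now apply ex_RInt_cont.
Qed.

Lemma RInt_chasles (a : R -> R) (x y z : R) :
  (forall t, continuous a t) -> RInt a x y + RInt a y z = RInt a x z.
Proof.
intros H. apply (@RInt_Chasles R_CompleteNormedModule); now apply ex_RInt_cont.
Qed.

Lemma RInt_same (a : R -> R) (x : R) : RInt a x x = 0.
Proof. apply (@RInt_point R_CompleteNormedModule). Qed.

Lemma RInt_rev (a : R -> R) (x y : R) :
  (forall t, continuous a t) -> RInt a x y = - RInt a y x.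
Proof.
intros H. generalize (RInt_chasles a x y x H). rewrite RInt_same. lra.
Qed.

Lemma is_derive_mult_exp_opp (f g : R -> R) (x df dg : R) :
  is_derive f x df -> is_derive g x dg ->
  is_derive (fun t => f t * exp (- g t)) x ((df - f x * dg) * exp (- g x)).
Proof.
intros D1 D2. auto_derive.
- repeat split; eexists; eassumption.
- rewrite (is_derive_unique (fun t : R => f t) _ _ D1).
  rewrite (is_derive_unique (fun t : R => g t) _ _ D2). ring.
Qed.

(** The product of [w] with the exponential of minus a primitive of [a] has zero derivative. *)
Lemma linear_ode (a w : R -> R) (l r x y : R) :
  (forall z, continuous a z) ->
  (forall z, l < z < r -> is_derive w z (a z * w z)) ->
  l < x < r -> l < y < r -> w y = w x * exp (RInt a x y).
Proof.
intros Ha Hw Hx Hy.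
assert (E : w x * exp (- RInt a x x) = w y * exp (- RInt a x y)).
{ apply (derive_zero_eq (fun z => w z * exp (- RInt a x z)) l r); try assumption.
  intros z Hz.
  generalize (Hw z Hz) (is_derive_primitive a x z Ha). intros D1 D2.
  replace 0 with ((a z * w z - w z * a z) * exp (- RInt a x z)) by ring.
  now apply is_derive_mult_exp_opp. }
rewrite RInt_same, Ropp_0, exp_0 in E.
replace (w y) with (w y * exp (- RInt a x y) * exp (RInt a x y)).
- rewrite <- E. ring.
- rewrite Rmult_assoc, <- exp_plus.
  replace (- _ + _) with 0 by ring. rewrite exp_0. ring.
Qed.

Lemma exp_monotone (x y : R) : x <= y -> exp x <= exp y.
Proof.
intros [H | ->]; [left; now apply exp_increasing | apply Rle_refl].
Qed.

(** The function [E z * exp (- C z) - d * z] is nonincreasing, because the exponential weight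
    is at most [1] on the right half-line. *)
Lemma gronwall_right (E dE : R -> R) (C d r y : R) :
  0 <= C -> 0 <= d ->
  (forall z, - r < z < r -> is_derive E z (dE z)) ->
  (forall z, - r < z < r -> dE z <= C * E z + d) ->
  0 <= y < r -> E y <= (E 0 + d * y) * exp (C * y).
Proof.
intros HC Hd HE HdE Hy.
set (F := fun z => E 0 + d * z - E z * exp (- (C * z))).
assert (D : forall z, - r < z < r ->
   is_derive F z (d - (dE z - C * E z) * exp (- (C * z)))).
{ intros z Hz. generalize (HE z Hz). intros D1. unfold F.
  auto_derive.
  - repeat split; eexists; eassumption.
  - rewrite (is_derive_unique (fun t : R => E t) _ _ D1). ring. }
assert (P : F 0 <= F y).
{ apply (derive_nonneg_le F (fun z => d - (dE z - C * E z) * exp (- (C * z)))).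
  - lra.
  - intros x Hx. apply D. lra.
  - intros x Hx. eapply is_derive_continuous, D. lra.
  - intros x Hx.
    assert (K : exp (- (C * x)) <= 1).
    { rewrite <- exp_0. apply exp_monotone. nra. }
    generalize (exp_pos (- (C * x))) (HdE x ltac:(lra)). intros. nra. }
unfold F in P.
rewrite !Rmult_0_r, Ropp_0, exp_0 in P.
replace (E y) with (E y * exp (- (C * y)) * exp (C * y)).
- apply Rmult_le_compat_r; [apply Rlt_le, exp_pos | lra].
- rewrite Rmult_assoc, <- exp_plus.
  replace (- _ + _) with 0 by ring. rewrite exp_0. ring.
Qed.

Lemma is_derive_reflect (f : R -> R) (x l : R) :
  is_derive f (- x) l -> is_derive (fun z => f (- z)) x (- l).
Proof.
intros D. auto_derive.
- now exists l.
- rewrite (is_derive_unique (fun t : R => f t) _ _ D). ring.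
Qed.

(** A bound on the absolute value of [dE] is invariant under [y -> - y], so the estimate on
    the left half-line is the one on the right for the reflected function. *)
Lemma gronwall (E dE : R -> R) (C d r y : R) :
  0 <= C -> 0 <= d ->
  (forall z, - r < z < r -> is_derive E z (dE z)) ->
  (forall z, - r < z < r -> Rabs (dE z) <= C * E z + d) ->
  - r < y < r -> E y <= (E 0 + d * Rabs y) * exp (C * Rabs y).
Proof.
intros HC Hd HE HdE Hy.
destruct (Rle_dec 0 y) as [P|P].
- rewrite Rabs_pos_eq by lra.
  apply (gronwall_right E dE C d r y); try assumption; try lra.
  intros z Hz. generalize (Rle_abs (dE z)) (HdE z Hz). lra.
- rewrite Rabs_left by lra.
  assert (G : E (- - y) <= (E (- 0) + d * - y) * exp (C * - y)).
  { apply (gronwall_right (fun z => E (- z)) (fun z => - dE (- z)) C d r (- y));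
      try assumption; try lra.
    - intros z Hz. apply is_derive_reflect, HE. lra.
    - intros z Hz. generalize (Rle_abs (- dE (- z))) (HdE (- z) ltac:(lra)).
      rewrite Rabs_Ropp. lra. }
  now rewrite Ropp_involutive, Ropp_0 in G.
Qed.

(** * Limits of sequences of functions *)

(** The Lipschitz bound gives the first-order Taylor remainder [B * |z - y| ^ 2] with [B] the
    same for all [n]; this inequality passes to the pointwise limit, whence differentiability. *)
Lemma derive_of_limit (f g : R -> R) (fn gn : nat -> R -> R) (y r B : R) :
  0 < r ->
  eventually (fun n => forall z, y - r < z < y + r ->
    is_derive (fn n) z (gn n z) /\ Rabs (gn n z - gn n y) <= B * Rabs (z - y)) ->
  (forall z, y - r < z < y + r -> is_lim_seq (fun n => fn n z) (f z)) ->
  is_lim_seq (fun n => gn n y) (g y) ->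
  is_derive f y (g y).
Proof.
intros Hr Hn Hf Hg.
assert (HB : 0 <= B).
{ destruct Hn as [N HN]. destruct (HN N (Nat.le_refl N) (y + r / 2) ltac:(lra)) as [_ H].
  generalize (Rabs_pos (gn N (y + r / 2) - gn N y)).
  replace (y + r / 2 - y) with (r / 2) in H by ring.
  rewrite (Rabs_pos_eq (r / 2)) in H by lra. nra. }
assert (Q : forall z, y - r < z < y + r ->
  Rabs (f z - f y - g y * (z - y)) <= B * Rabs (z - y) * Rabs (z - y)).
{ intros z Hz.
  assert (L : is_lim_seq (fun n => Rabs (fn n z - fn n y - gn n y * (z - y)))
                (Rabs (f z - f y - g y * (z - y)))).
  { apply (is_lim_seq_abs _ (Finite (f z - f y - g y * (z - y)))).
    apply is_lim_seq_minus'; [apply is_lim_seq_minus'|].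
    - now apply Hf.
    - apply Hf. lra.
    - apply (is_lim_seq_scal_r _ (z - y) (Finite (g y))). exact Hg. }
  refine (is_lim_seq_le_loc _ _ _ (Finite _) _ L (is_lim_seq_const _)).
  destruct Hn as [N HN]. exists N. intros n Hn.
  specialize (HN n Hn).
  destruct (MVT_gen (fn n) y z (gn n)) as [c [Hc E]].
  - intros x Hx. apply HN.
    unfold Rmin, Rmax in Hx; destruct (Rle_dec y z); lra.
  - intros x Hx. apply continuity_pt_filterlim.
    apply (is_derive_continuous _ _ (gn n x)), HN.
    unfold Rmin, Rmax in Hx; destruct (Rle_dec y z); lra.
  - assert (Hc' : y - r < c < y + r /\ Rabs (c - y) <= Rabs (z - y)).
    { unfold Rmin, Rmax in Hc. destruct (Rle_dec y z).
      - rewrite !Rabs_pos_eq by lra. lra.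
      - rewrite !Rabs_left1 by lra. lra. }
    destruct Hc' as [Hc1 Hc2]. destruct (HN c Hc1) as [_ H2].
    rewrite E. replace (gn n c * (z - y) - gn n y * (z - y))
      with ((gn n c - gn n y) * (z - y)) by ring.
    rewrite Rabs_mult. apply Rmult_le_compat_r; [apply Rabs_pos|].
    apply Rle_trans with (1 := H2). now apply Rmult_le_compat_l. }
apply is_derive_Reals. intros eps Heps.
assert (Hd : 0 < Rmin r (eps / (B + 1))).
{ apply Rmin_pos; [assumption|]. apply Rdiv_lt_0_compat; lra. }
exists (mkposreal _ Hd). intros h Hh0 Hh. simpl in Hh.
assert (Hh1 : Rabs h < r) by (eapply Rlt_le_trans; [exact Hh | apply Rmin_l]).
assert (Hh2 : Rabs h < eps / (B + 1)) by (eapply Rlt_le_trans; [exact Hh | apply Rmin_r]).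
apply Rabs_lt_between in Hh1.
specialize (Q (y + h) ltac:(lra)).
replace (y + h - y) with h in Q by ring.
replace ((f (y + h) - f y) / h - g y) with ((f (y + h) - f y - g y * h) / h) by (field; exact Hh0).
unfold Rdiv. rewrite Rabs_mult, Rabs_inv.
assert (Hp : 0 < Rabs h) by now apply Rabs_pos_lt.
apply Rle_lt_trans with (B * Rabs h).
- apply Rmult_le_reg_r with (Rabs h); [assumption|].
  rewrite Rmult_assoc, Rinv_l by lra. lra.
- apply Rmult_lt_compat_r with (r := B + 1) in Hh2; [|lra].
  unfold Rdiv in Hh2. rewrite Rmult_assoc, Rinv_l in Hh2 by lra. nra.
Qed.

Lemma extraction_mono (phi : nat -> nat) :
  extraction phi -> forall n k, (n < k)%nat -> (phi n < phi k)%nat.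
Proof.
intros H n k Hnk. induction Hnk as [|k Hnk IH]; [apply H|].
specialize (H k). lia.
Qed.

Lemma extraction_comp (phi psi : nat -> nat) :
  extraction phi -> extraction psi -> extraction (fun n => phi (psi n)).
Proof.
intros H1 H2 n. apply extraction_mono; auto.
Qed.

Lemma is_lim_seq_extraction (s : nat -> R) (l : Rbar) (phi : nat -> nat) :
  extraction phi -> is_lim_seq s l -> is_lim_seq (fun n => s (phi n)) l.
Proof.
intros H. apply is_lim_seq_subseq. now apply eventually_subseq.
Qed.

(** A cluster point is approached along an extraction that picks the term [n] within
    [1 / (n + 1)] of it, beyond all terms picked before. *)
Lemma bolzano_weierstrass_extraction (s : nat -> R) (L : R) :
  (forall n, Rabs (s n) <= L) ->
  exists (phi : nat -> nat) (l : R),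
    extraction phi /\ is_lim_seq (fun n => s (phi n)) l.
Proof.
intros HL.
destruct (Bolzano_Weierstrass s (fun x => - L <= x <= L)) as [l Hl].
- apply compact_P3.
- intros n. apply Rabs_le_between, HL.
- assert (N : forall (p : nat) (k : nat), exists q, (p < q)%nat /\ Rabs (s q - l) < / INR (S k)).
  { intros p k.
    assert (Hk : 0 < / INR (S k)) by (apply Rinv_0_lt_compat, lt_0_INR; lia).
    destruct (Hl (fun x => Rabs (x - l) < / INR (S k)) (S p)) as [q [Hq1 Hq2]].
    - exists (mkposreal _ Hk). intros x Hx. exact Hx.
    - exists q. split; [lia|assumption]. }
  set (next := fun p k => proj1_sig (constructive_indefinite_description _ (N p k))).
  assert (Hnext : forall p k, (p < next p k)%nat /\ Rabs (s (next p k) - l) < / INR (S k)).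
  { intros p k. unfold next. destruct (constructive_indefinite_description _ _) as [q Hq]. exact Hq. }
  set (phi := fix phi n := match n with O => next O O | S n => next (phi n) (S n) end).
  exists phi, l. split.
  + intros n. simpl. apply Hnext.
  + apply is_lim_seq_spec. intros eps.
    destruct (archimed_cor1 eps (cond_pos eps)) as [K [HK HK0]].
    exists K. intros n Hn.
    assert (Hphi : Rabs (s (phi n) - l) < / INR (S n)) by (destruct n; apply Hnext).
    apply Rlt_trans with (1 := Hphi). apply Rle_lt_trans with (2 := HK).
    apply Rinv_le_contravar; [apply lt_0_INR; lia | apply le_INR; lia].
Qed.

Lemma nondecreasing_limit_right (f : R -> R) (B : R) :
  nondecreasing f -> (forall x, f x <= B) ->
  exists l : R, is_lim f p_infty l /\ forall x, f x <= l.
Proof.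
intros Hf HB.
destruct (completeness (fun r => exists x, r = f x)) as [l [Hl1 Hl2]].
- exists B. intros r [x ->]. apply HB.
- now exists (f 0), 0.
- assert (Hle : forall x, f x <= l) by (intros x; apply Hl1; now exists x).
  exists l. split; [|exact Hle].
  apply is_lim_spec. intros eps.
  assert (X : exists x, l - eps < f x).
  { apply NNPP. intros N.
    assert (l <= l - eps); [|generalize (cond_pos eps); lra].
    apply Hl2. intros r [x ->]. apply Rnot_lt_le. intros H. apply N. now exists x. }
  destruct X as [x Hx]. exists x. intros z Hz.
  generalize (Hf x z ltac:(lra)) (Hle z). intros.
  apply Rabs_lt_between. generalize (cond_pos eps). lra.
Qed.

Lemma is_lim_reflect (f : R -> R) (l : R) :
  is_lim (fun x => f (- x)) p_infty l -> is_lim f m_infty l.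
Proof.
intros H. apply is_lim_spec. apply is_lim_spec in H. intros eps.
destruct (H eps) as [A HA]. exists (- A). intros x Hx.
specialize (HA (- x) ltac:(lra)). now rewrite Ropp_involutive in HA.
Qed.

Lemma is_lim_neg (f : R -> R) (x : Rbar) (l : R) :
  is_lim (fun z => - f z) x l -> is_lim f x (- l).
Proof.
intros H.
apply is_lim_ext with (fun z => - - f z); [intros; ring|].
apply (is_lim_opp _ _ (Finite l)). exact H.
Qed.

Lemma monotone_limits (f : R -> R) (lo hi : R) :
  nondecreasing f \/ nonincreasing f -> (forall x, lo <= f x <= hi) ->
  exists lm lp : R, is_lim f m_infty lm /\ is_lim f p_infty lp /\
    lo <= lm <= hi /\ lo <= lp <= hi.
Proof.
intros Hmon Hb.
assert (B : forall (x : Rbar) (l : R), (x = m_infty \/ x = p_infty) -> is_lim f x l -> lo <= l <= hi).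
{ intros x l Hx Hl. split.
  - apply (is_lim_le_loc (fun _ => lo) f x lo l); [|apply is_lim_const|exact Hl].
    destruct Hx as [-> | ->]; exists 0; intros; apply Hb.
  - apply (is_lim_le_loc f (fun _ => hi) x l hi); [|exact Hl|apply is_lim_const].
    destruct Hx as [-> | ->]; exists 0; intros; apply Hb. }
enough (L : exists lm lp : R, is_lim f m_infty lm /\ is_lim f p_infty lp).
{ destruct L as [lm [lp [H1 H2]]]. exists lm, lp.
  repeat split; try assumption; [apply (B m_infty)|apply (B m_infty)|apply (B p_infty)|apply (B p_infty)]; auto. }
destruct Hmon as [Hm|Hm].
- destruct (nondecreasing_limit_right f hi) as [lp [Hp _]]; [assumption|intros; apply Hb|].
  destruct (nondecreasing_limit_right (fun x => - f (- x)) (- lo)) as [lm [Hl _]].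
  { intros x y Hxy. apply Ropp_le_contravar, Hm. lra. }
  { intros x. generalize (Hb (- x)). lra. }
  exists (- lm), lp. split; [|assumption].
  now apply is_lim_reflect, is_lim_neg.
- destruct (nondecreasing_limit_right (fun x => - f x) (- lo)) as [lp [Hp _]].
  { intros x y Hxy. apply Ropp_le_contravar, Hm. lra. }
  { intros x. generalize (Hb x). lra. }
  destruct (nondecreasing_limit_right (fun x => f (- x)) hi) as [lm [Hl _]].
  { intros x y Hxy. apply Hm. lra. }
  { intros x. apply Hb. }
  exists lm, (- lp). split; [now apply is_lim_reflect|now apply is_lim_neg].
Qed.

(** * The Gaussian profile *)

Lemma gauss_pos (s : R) : 0 < gauss s.
Proof. apply exp_pos. Qed.

Lemma gauss_le_1 (s : R) : gauss s <= 1.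
Proof.
rewrite <- exp_0. apply exp_monotone. nra.
Qed.

Lemma gauss_even (s : R) : gauss (- s) = gauss s.
Proof. unfold gauss. f_equal. field. Qed.

Lemma is_derive_gauss (s : R) : is_derive gauss s (- s * gauss s).
Proof.
unfold gauss. auto_derive; [exact I|].
replace (s * (s * 1) * / 2) with (s ^ 2 / 2) by field. field.
Qed.

Lemma continuous_gauss (s : R) : continuous gauss s.
Proof. eapply is_derive_continuous, is_derive_gauss. Qed.

Definition gauss_area (y : R) : R := RInt gauss 0 y.

Lemma is_derive_gauss_area (y : R) : is_derive gauss_area y (gauss y).
Proof. apply is_derive_primitive, continuous_gauss. Qed.

Lemma continuous_gauss_area (y : R) : continuous gauss_area y.
Proof. eapply is_derive_continuous, is_derive_gauss_area. Qed.

Lemma gauss_area_0 : gauss_area 0 = 0.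
Proof. apply RInt_same. Qed.

Lemma gauss_area_opp (y : R) : gauss_area (- y) = - gauss_area y.
Proof.
set (F := fun z => gauss_area z + gauss_area (- z)).
assert (E : F y = F 0).
{ apply (derive_zero_eq F (- Rabs y - 1) (Rabs y + 1)).
  - intros z _. replace 0 with (gauss z + - gauss (- z)) by (rewrite gauss_even; ring).
    apply (@is_derive_plus R_AbsRing R_NormedModule).
    + apply is_derive_gauss_area.
    + apply (is_derive_reflect gauss_area), is_derive_gauss_area.
  - generalize (Rle_abs y) (Rle_abs (- y)). rewrite Rabs_Ropp. lra.
  - generalize (Rabs_pos y). lra. }
unfold F in E. rewrite Ropp_0, gauss_area_0 in E. lra.
Qed.

Lemma gauss_area_increasing : strictly_increasing gauss_area.
Proof.
intros x y Hxy.
destruct (mean_value gauss_area gauss x y) as [c [_ E]].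
- lra.
- intros; apply is_derive_gauss_area.
- intros; apply continuous_gauss_area.
- generalize (gauss_pos c). intros. nra.
Qed.

Lemma gauss_area_nondecreasing : nondecreasing gauss_area.
Proof.
intros x y [H | ->]; [left; now apply gauss_area_increasing | apply Rle_refl].
Qed.

Lemma gauss_area_pos (y : R) : 0 < y -> 0 < gauss_area y.
Proof. intros H. rewrite <- gauss_area_0. now apply gauss_area_increasing. Qed.

(** Since [s - 1 / 2 <= s ^ 2 / 2], the Gaussian is dominated by [exp (1 / 2 - s)]. *)
Lemma gauss_area_bounded (y : R) : gauss_area y <= exp (/ 2).
Proof.
destruct (Rle_dec 0 y) as [P|P].
- set (F := fun z => - exp (/ 2 - z) - gauss_area z).
  assert (D : F 0 <= F y).
  { assert (D : forall x, is_derive F x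
                     (exp (/ 2 - x) - gauss x)).
    { intros x. apply (@is_derive_minus R_AbsRing R_NormedModule).
      - auto_derive; [exact I | unfold Rminus; ring].
      - apply is_derive_gauss_area. }
    apply derive_nonneg_le with (fun x => exp (/ 2 - x) - gauss x); try assumption.
    - intros; apply D.
    - intros; eapply is_derive_continuous, D.
    - intros x _. apply -> Rminus_le_0. apply exp_monotone. generalize (pow2_ge_0 (x - 1)). intros. lra. }
  unfold F in D. rewrite gauss_area_0, !Rminus_0_r in D.
  generalize (exp_pos (/ 2 - y)). lra.
- apply Rle_trans with (gauss_area 0); [apply gauss_area_nondecreasing; lra|].
  rewrite gauss_area_0. left. apply exp_pos.
Qed.

(** For [t >= x >= 0] one has [t ^ 2 >= x ^ 2 + (t - x) ^ 2], that is
    [gauss t <= gauss x * gauss (t - x)]; integrate from [x] to [z]. *)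
Lemma gauss_area_shift (x z : R) :
  0 <= x <= z -> gauss_area z - gauss_area x <= gauss x * gauss_area (z - x).
Proof.
intros Hx.
set (F := fun t => gauss x * gauss_area (t - x) - gauss_area t).
assert (D : forall t, is_derive F t (gauss x * gauss (t - x) - gauss t)).
{ intros t. apply (@is_derive_minus R_AbsRing R_NormedModule); [|apply is_derive_gauss_area].
  apply (is_derive_scal (fun t => gauss_area (t - x)) t (gauss x)).
  generalize (is_derive_gauss_area (t + - x)). intros D.
  auto_derive; [eexists; exact D|].
  rewrite (is_derive_unique (fun t : R => gauss_area t) _ _ D). unfold Rminus. ring. }
assert (P : F x <= F z).
{ apply derive_nonneg_le with (fun t => gauss x * gauss (t - x) - gauss t).
  - lra.
  - intros; apply D.
  - intros; eapply is_derive_continuous, D.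
  - intros t Ht. apply -> Rminus_le_0. unfold gauss. rewrite <- exp_plus.
    apply exp_monotone. nra. }
unfold F in P. replace (x - x) with 0 in P by ring. rewrite gauss_area_0 in P. lra.
Qed.

Lemma gauss_half_mass_exists :
  exists H : R, is_lim gauss_area p_infty H /\ forall x, gauss_area x <= H.
Proof.
apply nondecreasing_limit_right with (exp (/ 2)).
- apply gauss_area_nondecreasing.
- apply gauss_area_bounded.
Qed.

(** The integral of [gauss] over the half-line, [sqrt (PI / 2)]. *)
Definition half_mass : R :=
  proj1_sig (constructive_indefinite_description _ gauss_half_mass_exists).

Lemma half_mass_lim : is_lim gauss_area p_infty half_mass.
Proof. apply (proj2_sig (constructive_indefinite_description _ gauss_half_mass_exists)). Qed.

Lemma gauss_area_le_half_mass (y : R) : gauss_area y <= half_mass.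
Proof. apply (proj2_sig (constructive_indefinite_description _ gauss_half_mass_exists)). Qed.

Lemma half_mass_pos : 0 < half_mass.
Proof.
apply Rlt_le_trans with (gauss_area 1).
- apply gauss_area_pos. lra.
- apply gauss_area_le_half_mass.
Qed.

Lemma gauss_area_abs (y : R) : Rabs (gauss_area y) <= half_mass.
Proof.
apply Rabs_le_between. generalize (gauss_area_le_half_mass y) (gauss_area_le_half_mass (- y)).
rewrite gauss_area_opp. lra.
Qed.

(** The limit [z -> oo] of [gauss_area_shift]. *)
Lemma gauss_tail (x : R) : 0 <= x -> half_mass - gauss_area x <= half_mass * gauss x.
Proof.
intros Hx.
assert (L : half_mass <= gauss_area x + half_mass * gauss x).
{ apply (is_lim_le_loc gauss_area (fun _ => gauss_area x + half_mass * gauss x) p_infty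
     half_mass (gauss_area x + half_mass * gauss x)).
  - exists x. intros z Hz.
    generalize (gauss_area_shift x z ltac:(lra)) (gauss_area_le_half_mass (z - x)) (gauss_pos x).
    intros. nra.
  - apply half_mass_lim.
  - apply is_lim_const. }
lra.
Qed.

Lemma half_mass_lim_left : is_lim gauss_area m_infty (- half_mass).
Proof.
apply is_lim_reflect.
apply is_lim_ext with (fun x => - gauss_area x).
- intros x. now rewrite gauss_area_opp.
- apply (is_lim_opp _ _ (Finite half_mass)), half_mass_lim.
Qed.

(** Stated for arbitrary filters so that one proof serves both improper integrals in [Vlim]. *)
Lemma is_RInt_gen_gauss (Fa Fb : (R -> Prop) -> Prop) {FFa : ProperFilter Fa} {FFb : ProperFilter Fb} (la lb : R) :
  filterlim gauss_area Fa (locally la) -> filterlim gauss_area Fb (locally lb) ->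
  is_RInt_gen gauss Fa Fb (lb - la).
Proof.
intros Ha Hb.
assert (E : forall x, Derive gauss_area x = gauss x)
  by (intros x; apply is_derive_unique, is_derive_gauss_area).
apply is_RInt_gen_ext with (Derive gauss_area).
- apply filter_forall. intros p x _. apply E.
- apply is_RInt_gen_Derive; try assumption.
  + apply filter_forall. intros p x _. eexists. apply is_derive_gauss_area.
  + apply filter_forall. intros p x _.
    apply continuous_ext with gauss; [intros; now rewrite E | apply continuous_gauss].
Qed.

(** With [T] the area and [H] its limit, oddness of [T] turns the normalization
    [-1 + 2 * (T y + H) / (2 * H)] into [T y / H]. *)
Lemma Vlim_eq (y : R) : Vlim y = gauss_area y / half_mass.
Proof.
unfold Vlim.
rewrite (is_RInt_gen_unique gauss (gauss_area y - - half_mass)).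
2: { apply (is_RInt_gen_gauss (Rbar_locally m_infty) (at_point y)).
     - apply half_mass_lim_left.
     - intros P HP. unfold filtermap, at_point. now apply locally_singleton. }
rewrite (is_RInt_gen_unique gauss (half_mass - - half_mass)).
2: { apply (is_RInt_gen_gauss (Rbar_locally m_infty) (Rbar_locally p_infty)).
     - apply half_mass_lim_left.
     - apply half_mass_lim. }
generalize half_mass_pos. intros. field. lra.
Qed.

Lemma is_derive_Vlim (y : R) : is_derive Vlim y (/ half_mass * gauss y).
Proof.
apply is_derive_ext with (fun z => / half_mass * gauss_area z).
- intros z. rewrite Vlim_eq. apply Rmult_comm.
- apply (is_derive_scal gauss_area), is_derive_gauss_area.
Qed.

Lemma continuous_Vlim (y : R) : continuous Vlim y.
Proof. eapply is_derive_continuous, is_derive_Vlim. Qed.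

Lemma Vlim_opp (y : R) : Vlim (- y) = - Vlim y.
Proof. rewrite !Vlim_eq, gauss_area_opp. unfold Rdiv. ring. Qed.

Lemma Vlim_increasing : strictly_increasing Vlim.
Proof.
intros x y Hxy. rewrite !Vlim_eq. apply Rmult_lt_compat_r.
- apply Rinv_0_lt_compat, half_mass_pos.
- now apply gauss_area_increasing.
Qed.

Lemma Vlim_bound (y : R) : -1 <= Vlim y <= 1.
Proof.
generalize half_mass_pos (gauss_area_abs y). intros H A.
apply Rabs_le_between in A. rewrite Vlim_eq. unfold Rdiv.
assert (I : half_mass * / half_mass = 1) by (apply Rinv_r; lra).
generalize (Rinv_0_lt_compat _ H). intros. nra.
Qed.

Lemma Vlim_tail (y : R) : 0 <= y -> 1 - Vlim y <= gauss y.
Proof.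
intros Hy. generalize half_mass_pos (gauss_tail y Hy). intros H T.
rewrite Vlim_eq.
apply Rmult_le_reg_l with half_mass; [assumption|].
replace (half_mass * (1 - gauss_area y / half_mass)) with (half_mass - gauss_area y)
  by (field; lra).
exact T.
Qed.

(** A space of functions that contains the derivative of [Vlim] and is stable under
    differentiation; this is how smoothness to all orders is obtained by induction. *)
Inductive hermite_span : (R -> R) -> Prop :=
| hermite_mono (c : R) (n : nat) : hermite_span (fun y => c * y ^ n * gauss y)
| hermite_add (f g : R -> R) :
    hermite_span f -> hermite_span g -> hermite_span (fun y => f y + g y).

Lemma hermite_span_derive (f : R -> R) :
  hermite_span f -> exists g, hermite_span g /\ forall x, is_derive f x (g x).
Proof.
induction 1 as [c n | f1 f2 H1 [g1 [S1 D1]] H2 [g2 [S2 D2]]].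
- exists (fun y => c * INR n * y ^ pred n * gauss y + - c * y ^ S n * gauss y). split.
  + apply (hermite_add (fun y => c * INR n * y ^ pred n * gauss y)
                       (fun y => - c * y ^ S n * gauss y)); apply hermite_mono.
  + intros x. generalize (is_derive_gauss x). intros D.
    auto_derive; [eexists; exact D|].
    rewrite (is_derive_unique (fun t : R => gauss t) _ _ D). simpl. ring.
- exists (fun y => g1 y + g2 y). split.
  + now apply hermite_add.
  + intros x. apply (@is_derive_plus R_AbsRing R_NormedModule); auto.
Qed.

Lemma Vlim_derive_n (k : nat) :
  exists g, hermite_span g /\ forall x, Derive_n Vlim (S k) x = g x.
Proof.
induction k as [|k [g [Hg IH]]].
- exists (fun y => / half_mass * y ^ 0 * gauss y). split; [apply hermite_mono|].
  intros x. simpl. rewrite (is_derive_unique (fun t : R => Vlim t) _ _ (is_derive_Vlim x)). ring.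
- destruct (hermite_span_derive g Hg) as [h [Hh D]].
  exists h. split; [assumption|]. intros x.
  change (Derive (Derive_n Vlim (S k)) x = h x).
  rewrite (Derive_ext _ _ x IH). now apply is_derive_unique.
Qed.

Lemma Vlim_smooth (k : nat) : Ck k Vlim.
Proof.
intros j x _. destruct j as [|j].
- split; [exact I | apply continuous_Vlim].
- assert (E : forall g, hermite_span g -> forall f, (forall z, f z = g z) -> ex_derive f x).
  { intros g Hg f E. destruct (hermite_span_derive g Hg) as [h [_ D]].
    apply ex_derive_ext with g; [intros; symmetry; apply E|]. exists (h x). apply D. }
  split.
  + destruct j as [|j].
    * exists (/ half_mass * gauss x). apply is_derive_Vlim.
    * destruct (Vlim_derive_n j) as [g [Hg Eg]]. exact (E g Hg _ Eg).
  + destruct (Vlim_derive_n j) as [g [Hg Eg]].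
    apply (@ex_derive_continuous R_AbsRing R_NormedModule). exact (E g Hg _ Eg).
Qed.

(** * Transition layers *)

(** Extending a function by its boundary values is composing it with this projection, so
    continuity and monotonicity of extensions reduce to those of [clamp]. *)
Definition clamp (m x : R) : R := Rmax (- m) (Rmin m x).

Lemma clamp_bounds (m x : R) : 0 <= m -> - m <= clamp m x <= m.
Proof.
intros Hm. unfold clamp, Rmax, Rmin.
destruct (Rle_dec m x), (Rle_dec (- m) _); lra.
Qed.

Lemma clamp_monotone (m x y : R) : x <= y -> clamp m x <= clamp m y.
Proof.
intros H. apply Rle_max_compat_l. now apply Rle_min_compat_l.
Qed.

Lemma clamp_id (m x : R) : - m <= x <= m -> clamp m x = x.
Proof.
intros H. unfold clamp. rewrite Rmin_right by lra. apply Rmax_right. lra.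
Qed.

Lemma continuous_clamp (m x : R) : continuous (clamp m) x.
Proof.
apply (proj2 (filterlim_locally (clamp m) (clamp m x))).
intros eps. exists eps. intros y Hy.
change (Rabs (y - x) < eps) in Hy. change (Rabs (clamp m y - clamp m x) < eps).
apply Rle_lt_trans with (2 := Hy).
unfold clamp, Rmax, Rmin.
destruct (Rle_dec m x), (Rle_dec m y);
  repeat match goal with |- context [Rle_dec ?a ?b] => destruct (Rle_dec a b) end;
  unfold Rabs;
  repeat match goal with |- context [Rcase_abs ?a] => destruct (Rcase_abs a) end; lra.
Qed.

Lemma extend_clamp (M l r : R) (w : R -> R) (x : R) :
  0 < M -> w (- M) = l -> w M = r -> extend M l r w x = w (clamp M x).
Proof.
intros HM <- <-. unfold extend, clamp.
destruct (Rlt_dec x (- M)); [|destruct (Rlt_dec M x)].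
- rewrite Rmin_right by lra. now rewrite Rmax_left by lra.
- rewrite Rmin_left by lra. now rewrite Rmax_right by lra.
- rewrite Rmin_right by lra. now rewrite Rmax_right by lra.
Qed.

Lemma continuous_extend (M l r : R) (w : R -> R) (x : R) :
  0 < M -> w (- M) = l -> w M = r -> continuous_on_segment (- M) M w ->
  continuous (extend M l r w) x.
Proof.
intros HM Hl Hr Hw.
apply continuous_ext with (fun x => w (clamp M x)).
{ intros z. symmetry. now apply extend_clamp. }
unfold continuous.
apply filterlim_comp with (within (fun z => - M <= z <= M) (locally (clamp M x))).
- intros P HP. unfold within in HP.
  generalize (continuous_clamp M x _ HP). unfold filtermap.
  apply filter_imp. intros z Hz. apply Hz, clamp_bounds. lra.
- apply Hw, clamp_bounds. lra.
Qed.

(** A solution of [U'' = a U'] on [(-m, m)] from the state [l] to the state [r], continued by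
    constants. The slope is given as a globally defined exponential instead of [Derive U]:
    at the points [-m] and [m], where [U] may have a corner, it still has the sign and the
    bounds that the mean value theorem on closed intervals requires. *)
Record layer (l r m : R) (a U w : R -> R) : Prop := {
  layer_width : 0 < m;
  layer_continuous : forall y, continuous U y;
  layer_left : forall y, y <= - m -> U y = l;
  layer_right : forall y, m <= y -> U y = r;
  layer_drift : forall y, continuous a y;
  layer_slope : forall y, w y = w 0 * exp (RInt a 0 y);
  layer_derive : forall y, - m < y < m -> is_derive U y (w y)
}.

Arguments layer_width {l r m a U w}.
Arguments layer_continuous {l r m a U w}.
Arguments layer_left {l r m a U w}.
Arguments layer_right {l r m a U w}.
Arguments layer_drift {l r m a U w}.
Arguments layer_slope {l r m a U w}.
Arguments layer_derive {l r m a U w}.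

Lemma scale_lt (M eps y : R) :
  0 < eps -> (- (M / eps) < y < M / eps <-> - M < eps * y < M).
Proof.
intros He.
assert (E : eps * (M / eps) = M) by (field; lra).
set (m := M / eps) in *. split; intros H; split; nra.
Qed.

Lemma scale_le (M eps y : R) :
  0 < eps -> (- (M / eps) <= y <= M / eps <-> - M <= eps * y <= M).
Proof.
intros He.
assert (E : eps * (M / eps) = M) by (field; lra).
set (m := M / eps) in *. split; intros H; split; nra.
Qed.

Lemma continuous_rescaled (M l r eps : R) (w : R -> R) (y : R) :
  0 < M -> w (- M) = l -> w M = r -> continuous_on_segment (- M) M w ->
  continuous (rescaled M l r eps w) y.
Proof.
intros HM Hl Hr Hw. unfold rescaled.
apply (continuous_comp (fun y => eps * y) (extend M l r w)).
- apply (continuous_scal_r eps (fun y : R => y)), continuous_id.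
- now apply continuous_extend.
Qed.

(** Rescaling by [eps] multiplies the first derivative by [eps] and the second by [eps ^ 2]; the
    equation is then linear in the slope and [linear_ode] applies. *)
Lemma rescaled_layer (M l r eps : R) (w a : R -> R) :
  0 < M -> 0 < eps -> w (- M) = l -> w M = r -> continuous_on_segment (- M) M w ->
  (forall x, - M < x < M -> twice_derivable_at w x) ->
  (forall y, continuous a y) ->
  (forall y, - M < eps * y < M ->
     eps ^ 2 * Derive_n w 2 (eps * y) = a y * (eps * Derive w (eps * y))) ->
  layer l r (M / eps) a (rescaled M l r eps w)
    (fun y => eps * Derive w 0 * exp (RInt a 0 y)).
Proof.
intros HM He Hl Hr Hw Hd Ha Heq.
assert (Hm : 0 < M / eps) by now apply Rdiv_lt_0_compat.
split; try assumption.
- intros y. now apply continuous_rescaled.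
- intros y Hy. unfold rescaled. rewrite extend_clamp by assumption.
  unfold clamp.
  assert (eps * y <= - M).
  { apply Rmult_le_compat_l with (r := eps) in Hy; [|lra].
    replace (eps * - (M / eps)) with (- M) in Hy by (field; lra). exact Hy. }
  rewrite Rmin_right by lra. now rewrite Rmax_left by lra.
- intros y Hy. unfold rescaled. rewrite extend_clamp by assumption.
  unfold clamp.
  assert (M <= eps * y).
  { apply Rmult_le_compat_l with (r := eps) in Hy; [|lra].
    replace (eps * (M / eps)) with M in Hy by (field; lra). exact Hy. }
  rewrite Rmin_left by lra. now rewrite Rmax_right by lra.
- intros y. now rewrite RInt_same, exp_0, Rmult_1_r.
- assert (D : forall y, - (M / eps) < y < M / eps ->
     is_derive (rescaled M l r eps w) y (eps * Derive w (eps * y))).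
  { intros y Hy.
    apply is_derive_ext_loc with (fun y => w (eps * y)).
    - apply (locally_interval _ y (Finite (- (M / eps))) (Finite (M / eps))).
      + apply Hy.
      + apply Hy.
      + intros z H1 H2. simpl in H1, H2. unfold rescaled.
        rewrite extend_clamp by assumption. rewrite clamp_id; [reflexivity|].
        apply scale_le; [assumption|lra].
    - destruct (Hd (eps * y)) as [D _]; [now apply scale_lt|].
      auto_derive; [exact D|].
      change (Derive (fun x : R => w x)) with (Derive w). ring. }
  intros y Hy.
  replace (Derive w 0) with (Derive w (eps * 0)) by (f_equal; ring).
  rewrite <- (linear_ode a (fun y => eps * Derive w (eps * y)) (- (M / eps)) (M / eps)
               0 y Ha); [now apply D| |lra|assumption].
  intros z Hz.
  assert (Hz' : - M < eps * z < M) by now apply scale_lt.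
  rewrite <- (Heq z Hz').
  destruct (Hd (eps * z) Hz') as [_ D2].
  generalize (Derive_correct _ _ D2). intros D3.
  auto_derive; [exact D2|].
  change (Derive_n w 2) with (Derive (Derive w)).
  change (Derive (fun x : R => Derive w x)) with (Derive (Derive w)). ring.
Qed.

Lemma layer_slope_from (l r m : R) (a U w : R -> R) (x y : R) :
  layer l r m a U w -> w y = w x * exp (RInt a x y).
Proof.
intros L. rewrite (layer_slope L y), (layer_slope L x).
rewrite <- (RInt_chasles a 0 x y) by apply (layer_drift L).
rewrite exp_plus. ring.
Qed.

Lemma layer_slope_derive (l r m : R) (a U w : R -> R) (y : R) :
  layer l r m a U w -> is_derive w y (a y * w y).
Proof.
intros L.
apply is_derive_ext with (fun z => w 0 * exp (RInt a 0 z)).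
{ intros z. symmetry. apply (layer_slope L). }
rewrite (layer_slope L y).
replace (a y * (w 0 * exp (RInt a 0 y))) with (w 0 * (a y * exp (RInt a 0 y))) by ring.
apply (is_derive_scal (fun z => exp (RInt a 0 z))).
apply (is_derive_comp exp (RInt a 0)); [apply is_derive_exp|].
apply is_derive_primitive, (layer_drift L).
Qed.

Lemma layer_increment (l r m : R) (a U w : R -> R) (x y : R) :
  layer l r m a U w -> - m <= x -> x <= y -> y <= m ->
  exists c, x <= c <= y /\ U y - U x = w c * (y - x).
Proof.
intros L Hx Hxy Hy. apply mean_value; [assumption| |].
- intros z Hz. apply (layer_derive L). lra.
- intros z _. apply (layer_continuous L).
Qed.

Lemma layer_clamp (l r m : R) (a U w : R -> R) (y : R) :
  layer l r m a U w -> U y = U (clamp m y).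
Proof.
intros L. generalize (layer_width L). intros Hm. unfold clamp.
destruct (Rle_dec y (- m)); [|destruct (Rle_dec m y)].
- rewrite Rmin_right, Rmax_left by lra.
  rewrite !(layer_left L) by lra. reflexivity.
- rewrite Rmin_left, Rmax_right by lra.
  rewrite !(layer_right L) by lra. reflexivity.
- rewrite Rmin_right, Rmax_right by lra. reflexivity.
Qed.

(** Together with [layer_reflect], this symmetry reduces statements about layers to increasing
    layers and to their right end. *)
Lemma layer_neg (l r m : R) (a U w : R -> R) :
  layer l r m a U w -> layer (- l) (- r) m a (fun y => - U y) (fun y => - w y).
Proof.
intros [H1 H2 H3 H4 H5 H6 H7]. split; try assumption.
- intros y. apply (@continuous_opp R_UniformSpace R_AbsRing R_NormedModule), H2.
- intros y Hy. now rewrite H3.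
- intros y Hy. now rewrite H4.
- intros y. rewrite (H6 y). ring.
- intros y Hy. apply (is_derive_opp U). now apply H7.
Qed.

Lemma layer_reflect (l r m : R) (a U w : R -> R) :
  layer l r m a U w ->
  layer r l m (fun y => - a (- y)) (fun y => U (- y)) (fun y => - w (- y)).
Proof.
intros [H1 H2 H3 H4 H5 H6 H7].
assert (Ho : forall f : R -> R, (forall y, continuous f y) -> forall y, continuous (fun z => f (- z)) y).
{ intros f Hf y. apply (continuous_comp Ropp f); [|apply Hf].
  apply (@continuous_opp R_UniformSpace R_AbsRing R_NormedModule (fun z => z)), continuous_id. }
assert (Ha : forall y, continuous (fun y => - a (- y)) y).
{ intros y. apply (@continuous_opp R_UniformSpace R_AbsRing R_NormedModule). now apply Ho. }
split; try assumption.
- now apply Ho.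
- intros y Hy. apply H4. lra.
- intros y Hy. apply H3. lra.
- intros y. rewrite Ropp_0, (H6 (- y)), Ropp_mult_distr_l. do 2 f_equal.
  assert (E : RInt a 0 (- y) - RInt (fun s => - a (- s)) 0 y
            = RInt a 0 (- 0) - RInt (fun s => - a (- s)) 0 0).
  { apply (derive_zero_eq (fun y => RInt a 0 (- y) - RInt (fun s => - a (- s)) 0 y)
             (- Rabs y - 1) (Rabs y + 1)).
    - intros z _.
      apply (@eq_rect R (- a (- z) - - a (- z)) (is_derive _ z)); [|ring].
      apply (@is_derive_minus R_AbsRing R_NormedModule).
      + apply (is_derive_reflect (RInt a 0)), is_derive_primitive, H5.
      + apply (is_derive_primitive (fun s => - a (- s))), Ha.
    - generalize (Rle_abs y) (Rle_abs (- y)). rewrite Rabs_Ropp. lra.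
    - generalize (Rabs_pos y). lra. }
  rewrite Ropp_0, !RInt_same in E. lra.
- intros y Hy. apply is_derive_reflect, H7. lra.
Qed.

(** The slope is a constant times an exponential, and at a mean value point of the whole layer it
    has the sign of [r - l]. *)
Lemma layer_slope_nonneg (l r m : R) (a U w : R -> R) :
  layer l r m a U w -> l <= r -> forall y, 0 <= w y.
Proof.
intros L Hlr.
generalize (layer_width L). intros Hm.
destruct (layer_increment _ _ _ _ _ _ (- m) m L) as [c [_ E]]; try lra.
rewrite (layer_left L (- m)), (layer_right L m) in E by lra.
assert (Hc : 0 <= w c) by nra.
intros y. rewrite (layer_slope_from _ _ _ _ _ _ c y L).
apply Rmult_le_pos; [assumption | left; apply exp_pos].
Qed.

Lemma layer_nondecreasing (l r m : R) (a U w : R -> R) :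
  layer l r m a U w -> l <= r -> nondecreasing U.
Proof.
intros L Hlr x y Hxy.
generalize (layer_width L). intros Hm.
rewrite (layer_clamp _ _ _ _ _ _ x L), (layer_clamp _ _ _ _ _ _ y L).
generalize (clamp_bounds m x ltac:(lra)) (clamp_bounds m y ltac:(lra)) (clamp_monotone m x y Hxy).
intros Hx Hy H.
destruct (layer_increment _ _ _ _ _ _ (clamp m x) (clamp m y) L) as [c [_ E]]; try lra.
generalize (layer_slope_nonneg _ _ _ _ _ _ L Hlr c). intros. nra.
Qed.

Lemma layer_nonincreasing (l r m : R) (a U w : R -> R) :
  layer l r m a U w -> r <= l -> nonincreasing U.
Proof.
intros L Hlr x y Hxy. apply Ropp_le_cancel.
apply (layer_nondecreasing _ _ _ _ _ _ (layer_neg _ _ _ _ _ _ L)); lra.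
Qed.

Lemma layer_range (l r m : R) (a U w : R -> R) (y : R) :
  layer l r m a U w -> Rmin l r <= U y <= Rmax l r.
Proof.
intros L. generalize (layer_width L). intros Hm.
rewrite (layer_clamp _ _ _ _ _ _ y L).
generalize (clamp_bounds m y ltac:(lra)). intros Hy.
destruct (Rle_dec l r) as [H|H].
- rewrite Rmin_left, Rmax_right by lra.
  rewrite <- (layer_left L (- m)), <- (layer_right L m) by lra.
  split; apply (layer_nondecreasing _ _ _ _ _ _ L); lra.
- rewrite Rmin_right, Rmax_left by lra.
  rewrite <- (layer_left L (- m)), <- (layer_right L m) by lra.
  split; apply (layer_nonincreasing _ _ _ _ _ _ L); lra.
Qed.

Lemma RInt_abs_le (a : R -> R) (B x y : R) :
  (forall z, continuous a z) ->
  (forall z, Rmin x y <= z <= Rmax x y -> Rabs (a z) <= B) ->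
  Rabs (RInt a x y) <= B * Rabs (y - x).
Proof.
intros Ha HB.
destruct (MVT_gen (RInt a x) x y a) as [c [Hc E]].
- intros z _. now apply is_derive_primitive.
- intros z _. apply continuity_pt_filterlim.
  eapply is_derive_continuous. now apply is_derive_primitive.
- rewrite RInt_same, Rminus_0_r in E. rewrite E, Rabs_mult.
  apply Rmult_le_compat_r; [apply Rabs_pos | now apply HB].
Qed.

(** On an interval of length [d] with end point [y] the mean slope is at most
    [|r - l| / d], since [U] stays between its boundary values; from the mean value point to
    [y] the slope changes at most by the factor [exp (B * d)]. *)
Lemma layer_gradient_bound (l r m : R) (a U w : R -> R) (B d y : R) :
  layer l r m a U w -> (forall z, - m <= z <= m -> Rabs (a z) <= B) ->
  0 < d <= m -> - m <= y <= m ->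
  Rabs (w y) <= Rabs (r - l) / d * exp (B * d).
Proof.
intros L HB Hd Hy.
assert (Hlr : forall p q, Rabs (U p - U q) <= Rabs (r - l)).
{ intros p q. generalize (layer_range _ _ _ _ _ _ p L) (layer_range _ _ _ _ _ _ q L).
  unfold Rmin, Rmax. destruct (Rle_dec l r).
  - rewrite (Rabs_pos_eq (r - l)) by lra. intros. apply Rabs_le_between. lra.
  - rewrite (Rabs_left1 (r - l)) by lra. intros. apply Rabs_le_between. lra. }
assert (C : exists c, - m <= c <= m /\ Rabs (c - y) <= d /\ Rabs (w c) * d <= Rabs (r - l)).
{ (* The interval is taken towards the origin, so as to stay inside the layer. *)
  destruct (Rle_dec y 0) as [H|H].
  - destruct (layer_increment _ _ _ _ _ _ y (y + d) L) as [c [Hc E]]; try lra.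
    exists c. repeat split; try lra.
    + apply Rabs_le_between; lra.
    + rewrite <- (Rabs_pos_eq d) by lra. rewrite <- Rabs_mult.
      replace (w c * d) with (U (y + d) - U y) by (rewrite E; ring). apply Hlr.
  - destruct (layer_increment _ _ _ _ _ _ (y - d) y L) as [c [Hc E]]; try lra.
    exists c. repeat split; try lra.
    + apply Rabs_le_between; lra.
    + rewrite <- (Rabs_pos_eq d) by lra. rewrite <- Rabs_mult.
      replace (w c * d) with (U y - U (y - d)) by (rewrite E; ring). apply Hlr. }
destruct C as [c [Hc1 [Hc2 Hc3]]].
rewrite (layer_slope_from _ _ _ _ _ _ c y L), Rabs_mult, (Rabs_pos_eq (exp _)) by (left; apply exp_pos).
apply Rmult_le_compat; try apply Rabs_pos; try (left; apply exp_pos).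
- apply Rmult_le_reg_r with d; [lra|].
  unfold Rdiv. rewrite Rmult_assoc, Rinv_l by lra. lra.
- apply exp_monotone. apply Rle_trans with (1 := Rle_abs _).
  apply Rle_trans with (B * Rabs (y - c)).
  + apply RInt_abs_le; [apply (layer_drift L)|].
    intros z Hz. apply HB.
    unfold Rmin, Rmax in Hz. destruct (Rle_dec c y); lra.
  + apply Rmult_le_compat_l; [|rewrite Rabs_minus_sym; exact Hc2].
    apply Rle_trans with (2 := HB y Hy), Rabs_pos.
Qed.

Lemma RInt_opp_id (y : R) : RInt (fun s => - s) 0 y = - (y ^ 2 / 2).
Proof.
apply is_RInt_unique.
replace (- (y ^ 2 / 2)) with (- (y ^ 2 / 2) - - (0 ^ 2 / 2)) by (simpl; field).
apply (is_RInt_derive (fun s => - (s ^ 2 / 2))).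
- intros x _. auto_derive; [exact I | field].
- intros x _. apply (@continuous_opp R_UniformSpace R_AbsRing R_NormedModule (fun z => z)), continuous_id.
Qed.

(** Here the slope is a multiple of [gauss], so [V] is affine in [gauss_area], and the two boundary
    values determine the coefficients. *)
Lemma gaussian_layer (m : R) (V w : R -> R) :
  layer (-1) 1 m (fun y => - y) V w ->
  forall y, - m <= y <= m -> V y = gauss_area y / gauss_area m.
Proof.
intros L.
generalize (layer_width L). intros Hm.
set (b := w 0).
assert (I : forall x y, - m <= x -> x <= y -> y <= m ->
   V y - b * gauss_area y = V x - b * gauss_area x).
{ intros x y Hx Hxy Hy.
  destruct (mean_value (fun z => V z - b * gauss_area z) (fun _ => 0) x y Hxy) as [c [_ E]].
  - intros z Hz.
    replace 0 with (w z - b * gauss z).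
    + apply (@is_derive_minus R_AbsRing R_NormedModule).
      * apply (layer_derive L). lra.
      * apply (is_derive_scal gauss_area), is_derive_gauss_area.
    + rewrite (layer_slope L z), RInt_opp_id. unfold b, gauss. ring.
  - intros z _. apply (@continuous_minus R_UniformSpace R_AbsRing R_NormedModule).
    + apply (layer_continuous L).
    + apply (continuous_scal_r b gauss_area), continuous_gauss_area.
  - lra. }
assert (Hb : b * gauss_area m = 1).
{ generalize (I (- m) m ltac:(lra) ltac:(lra) ltac:(lra)).
  rewrite (layer_left L (- m)), (layer_right L m), gauss_area_opp by lra. lra. }
generalize (gauss_area_pos m Hm). intros HT.
intros y Hy.
generalize (I y m ltac:(lra) ltac:(lra) ltac:(lra)).
rewrite (layer_right L) by lra. intros E.
apply Rmult_eq_reg_r with (gauss_area m); [|lra].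
unfold Rdiv. rewrite Rmult_assoc, Rinv_l by lra.
replace (V y) with (b * gauss_area y) by lra.
rewrite Rmult_1_r. replace (b * gauss_area y * gauss_area m) with (b * gauss_area m * gauss_area y) by ring.
rewrite Hb. ring.
Qed.

Lemma gaussian_layer_lipschitz (m : R) (V w : R -> R) (x y : R) :
  layer (-1) 1 m (fun y => - y) V w -> - m <= x <= m -> - m <= y <= m ->
  Rabs (V y - V x) <= / gauss_area m * Rabs (y - x).
Proof.
intros L Hx Hy.
generalize (gauss_area_pos m (layer_width L)). intros HT.
rewrite !(gaussian_layer _ _ _ L) by assumption.
replace (gauss_area y / gauss_area m - gauss_area x / gauss_area m)
  with (/ gauss_area m * (gauss_area y - gauss_area x)) by (field; lra).
rewrite Rabs_mult, (Rabs_pos_eq (/ _)) by (left; now apply Rinv_0_lt_compat).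
apply Rmult_le_compat_l; [left; now apply Rinv_0_lt_compat|].
assert (E : gauss_area y - gauss_area x = RInt gauss x y).
{ generalize (RInt_chasles gauss 0 x y continuous_gauss). unfold gauss_area. lra. }
rewrite E, <- (Rmult_1_l (Rabs (y - x))). apply RInt_abs_le; [apply continuous_gauss|].
intros z _. rewrite Rabs_pos_eq by (left; apply gauss_pos). apply gauss_le_1.
Qed.

(** Inside the layer the error is [T y * (1 / T m - 1 / H)] with [|T y| <= T m], and outside it is
    [1 - T |y| / H]; both are at most the relative tail [(H - T m) / H]. *)
Lemma gaussian_layer_error (m : R) (V w : R -> R) (y : R) :
  layer (-1) 1 m (fun y => - y) V w -> Rabs (V y - Vlim y) <= gauss m.
Proof.
intros L.
generalize (layer_width L) half_mass_pos. intros Hm HH.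
assert (Out : forall z, m <= z -> 1 - Vlim z <= gauss m).
{ intros z Hz. apply Rle_trans with (1 - Vlim m); [|apply Vlim_tail; lra].
  destruct (Rle_lt_or_eq_dec _ _ Hz) as [H| ->]; [|lra].
  generalize (Vlim_increasing m z H). lra. }
destruct (Rle_dec y (- m)); [|destruct (Rle_dec m y)].
- rewrite (layer_left L) by assumption.
  generalize (Out (- y) ltac:(lra)) (Vlim_bound y). rewrite Vlim_opp.
  intros. rewrite Rabs_left1; lra.
- rewrite (layer_right L) by assumption.
  generalize (Out y ltac:(lra)) (Vlim_bound y).
  intros. rewrite Rabs_pos_eq; lra.
- rewrite (gaussian_layer _ _ _ L) by lra. rewrite Vlim_eq.
  generalize (gauss_area_pos m Hm) (gauss_area_le_half_mass m) (gauss_tail m ltac:(lra)). intros HT1 HT2 HT3.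
  assert (A : Rabs (gauss_area y) <= gauss_area m).
  { apply Rabs_le_between. rewrite <- gauss_area_opp. split; apply gauss_area_nondecreasing; lra. }
  replace (gauss_area y / gauss_area m - gauss_area y / half_mass)
    with (gauss_area y * ((half_mass - gauss_area m) / (gauss_area m * half_mass)))
    by (field; lra).
  assert (P : 0 <= (half_mass - gauss_area m) / (gauss_area m * half_mass)).
  { apply Rdiv_le_0_compat; [lra | apply Rmult_lt_0_compat; lra]. }
  rewrite Rabs_mult, (Rabs_pos_eq _ P).
  apply Rle_trans with (gauss_area m * ((half_mass - gauss_area m) / (gauss_area m * half_mass))).
  + now apply Rmult_le_compat_r.
  + apply Rmult_le_reg_l with half_mass; [assumption|].
    replace (half_mass * (gauss_area m * ((half_mass - gauss_area m) / (gauss_area m * half_mass))))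
      with (half_mass - gauss_area m) by (field; lra).
    exact HT3.
Qed.

(** * Characteristic speeds and rescaled solutions *)

Definition mixed_speed (fm fp : R -> R) (u v : R) : R :=
  / 2 * ((1 - v) * Derive fm u + (1 + v) * Derive fp u).

Record speed_bounds (fm fp : R -> R) (lo hi M K : R) : Prop := {
  sb_nonneg : 0 <= K;
  sb_lip_m : forall x y, Rabs (Derive fm x - Derive fm y) <= K * Rabs (x - y);
  sb_lip_p : forall x y, Rabs (Derive fp x - Derive fp y) <= K * Rabs (x - y);
  sb_max : forall u, lo <= u <= hi -> Rabs (Derive fm u) + Rabs (Derive fp u) <= M
}.

Arguments sb_nonneg {fm fp lo hi M K}.
Arguments sb_lip_m {fm fp lo hi M K}.
Arguments sb_lip_p {fm fp lo hi M K}.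
Arguments sb_max {fm fp lo hi M K}.

Lemma lipschitz_continuous (f : R -> R) (K x : R) :
  (forall x y, Rabs (f x - f y) <= K * Rabs (x - y)) -> continuous f x.
Proof.
intros H. apply (proj2 (filterlim_locally f (f x))). intros eps.
assert (HK : 0 < Rabs K + 1) by (generalize (Rabs_pos K); lra).
assert (Hd : 0 < eps / (Rabs K + 1)) by (apply Rdiv_lt_0_compat; [apply cond_pos | assumption]).
exists (mkposreal _ Hd). intros y Hy.
change (Rabs (y - x) < eps / (Rabs K + 1)) in Hy. change (Rabs (f y - f x) < eps).
apply Rle_lt_trans with (1 := H y x).
apply Rmult_lt_compat_l with (r := Rabs K + 1) in Hy; [|assumption].
replace ((Rabs K + 1) * (eps / (Rabs K + 1))) with (eps : R) in Hy by (field; lra).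
generalize (Rle_abs K) (Rabs_pos (y - x)). intros. nra.
Qed.

Lemma flux_speed_bounds (fm fp : R -> R) (uL uR M : R) :
  flux fm -> flux fp -> is_max_speed fm fp uL uR M ->
  exists K, speed_bounds fm fp (Rmin uL uR) (Rmax uL uR) M K.
Proof.
intros [_ [[K1 H1] _]] [_ [[K2 H2] _]] [HM _].
exists (Rabs K1 + Rabs K2). split.
- generalize (Rabs_pos K1) (Rabs_pos K2). lra.
- intros x y. apply Rle_trans with (1 := H1 x y).
  apply Rmult_le_compat_r; [apply Rabs_pos|].
  generalize (Rle_abs K1) (Rabs_pos K2). lra.
- intros x y. apply Rle_trans with (1 := H2 x y).
  apply Rmult_le_compat_r; [apply Rabs_pos|].
  generalize (Rle_abs K2) (Rabs_pos K1). lra.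
- intros u Hu. apply HM. now exists u.
Qed.

Lemma speed_continuous_m (fm fp : R -> R) (lo hi M K x : R) :
  speed_bounds fm fp lo hi M K -> continuous (Derive fm) x.
Proof. intros B. apply lipschitz_continuous with K, (sb_lip_m B). Qed.

Lemma speed_continuous_p (fm fp : R -> R) (lo hi M K x : R) :
  speed_bounds fm fp lo hi M K -> continuous (Derive fp) x.
Proof. intros B. apply lipschitz_continuous with K, (sb_lip_p B). Qed.

Lemma continuous_mixed_speed (fm fp : R -> R) (lo hi M K : R) (U V : R -> R) (y : R) :
  speed_bounds fm fp lo hi M K -> continuous U y -> continuous V y ->
  continuous (fun z => mixed_speed fm fp (U z) (V z)) y.
Proof.
intros B HU HV. unfold mixed_speed.
assert (C1 : continuous (fun z => Derive fm (U z)) y).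
{ apply (continuous_comp U (Derive fm)); [assumption|]. eapply speed_continuous_m, B. }
assert (C2 : continuous (fun z => Derive fp (U z)) y).
{ apply (continuous_comp U (Derive fp)); [assumption|]. eapply speed_continuous_p, B. }
apply (continuous_scal_r (/ 2) (fun z => (1 - V z) * Derive fm (U z) + (1 + V z) * Derive fp (U z))).
apply (@continuous_plus R_UniformSpace R_AbsRing R_NormedModule).
- apply (@continuous_mult R_UniformSpace R_AbsRing); [|assumption].
  apply (@continuous_minus R_UniformSpace R_AbsRing R_NormedModule); [apply continuous_const|assumption].
- apply (@continuous_mult R_UniformSpace R_AbsRing); [|assumption].
  apply (@continuous_plus R_UniformSpace R_AbsRing R_NormedModule); [apply continuous_const|assumption].
Qed.

(** The speed is a convex combination of [fm'] and [fp']. *)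
Lemma mixed_speed_bound (fm fp : R -> R) (lo hi M K u v : R) :
  speed_bounds fm fp lo hi M K -> lo <= u <= hi -> -1 <= v <= 1 ->
  Rabs (mixed_speed fm fp u v) <= M.
Proof.
intros B Hu Hv. apply Rle_trans with (2 := sb_max B u Hu).
unfold mixed_speed.
generalize (Derive fm u) (Derive fp u). intros p q.
apply Rabs_le_between. split_Rabs; nra.
Qed.

Lemma mixed_speed_lipschitz (fm fp : R -> R) (lo hi M K u1 v1 u2 v2 : R) :
  speed_bounds fm fp lo hi M K -> lo <= u2 <= hi -> -1 <= v1 <= 1 ->
  Rabs (mixed_speed fm fp u1 v1 - mixed_speed fm fp u2 v2)
  <= K * Rabs (u1 - u2) + M * Rabs (v1 - v2).
Proof.
intros B Hu Hv.
generalize (sb_max B u2 Hu) (sb_lip_m B u1 u2)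
  (sb_lip_p B u1 u2).
unfold mixed_speed.
generalize (Derive fm u1) (Derive fp u1) (Derive fm u2) (Derive fp u2) (K * Rabs (u1 - u2)).
intros p1 q1 p2 q2 k Hmax Hp Hq.
replace (/ 2 * ((1 - v1) * p1 + (1 + v1) * q1) - / 2 * ((1 - v2) * p2 + (1 + v2) * q2))
  with (/ 2 * ((1 - v1) * (p1 - p2) + (1 + v1) * (q1 - q2)) + / 2 * (q2 - p2) * (v1 - v2)) by field.
apply Rle_trans with (1 := Rabs_triang _ _). apply Rplus_le_compat.
- apply Rabs_le_between in Hp. apply Rabs_le_between in Hq. apply Rabs_le_between. nra.
- rewrite Rabs_mult. apply Rmult_le_compat_r; [apply Rabs_pos|].
  apply Rabs_le_between. split_Rabs; lra.
Qed.

(** The color [V] is described through its own layer because the estimates use its explicit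
    Gaussian form, while [w] is the slope of the state only. *)
Record viscous_layer (fm fp : R -> R) (uL uR M eps : R) (U V w : R -> R) : Prop := {
  vl_eps : 0 < eps;
  vl_U : layer uL uR (M / eps) (fun y => mixed_speed fm fp (U y) (V y) - eps * y) U w;
  vl_V : exists wV, layer (-1) 1 (M / eps) (fun y => - y) V wV
}.

Arguments vl_eps {fm fp uL uR M eps U V w}.
Arguments vl_U {fm fp uL uR M eps U V w}.
Arguments vl_V {fm fp uL uR M eps U V w}.

Lemma continuous_linear (c y : R) : continuous (fun z : R => c * z) y.
Proof. apply (continuous_scal_r c (fun z : R => z)), continuous_id. Qed.

Lemma solution_v_layer (fm fp : R -> R) (uL uR M eps : R) (u v : R -> R) :
  0 < M -> 0 < eps -> is_viscous_solution fm fp uL uR M eps u v ->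
  layer (-1) 1 (M / eps) (fun y => - y) (rescaled M (-1) 1 eps v)
    (fun y => eps * Derive v 0 * exp (RInt (fun y => - y) 0 y)).
Proof.
intros HM He S. destruct S as [Cu Cv Du Dv Eu Ev Lu Ru Lv Rv _ _ _ _]. apply rescaled_layer; try assumption.
- intros y. apply (@continuous_opp R_UniformSpace R_AbsRing R_NormedModule (fun z => z)), continuous_id.
- intros y Hy. rewrite <- Ev by assumption. ring.
Qed.

Lemma solution_viscous_layer (fm fp : R -> R) (uL uR M K eps : R) (u v : R -> R) :
  speed_bounds fm fp (Rmin uL uR) (Rmax uL uR) M K ->
  0 < M -> 0 < eps -> is_viscous_solution fm fp uL uR M eps u v ->
  exists w, viscous_layer fm fp uL uR M eps
    (rescaled M uL uR eps u) (rescaled M (-1) 1 eps v) w.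
Proof.
intros B HM He S. generalize (solution_v_layer _ _ _ _ _ _ _ _ HM He S). intros LV.
eexists. split; [assumption| |eexists; exact LV].
destruct S as [Cu Cv Du Dv Eu Ev Lu Ru Lv Rv _ _ _ _]. apply rescaled_layer; try assumption.
- intros y. apply (@continuous_minus R_UniformSpace R_AbsRing R_NormedModule).
  + eapply continuous_mixed_speed; [exact B| |apply (layer_continuous LV)].
    now apply continuous_rescaled.
  + apply continuous_linear.
- intros y Hy.
  unfold rescaled. rewrite !extend_clamp by assumption. rewrite !clamp_id by lra.
  replace (eps ^ 2 * Derive_n u 2 (eps * y)) with (eps * (eps * Derive_n u 2 (eps * y))) by ring.
  rewrite <- Eu by assumption. unfold mixed_speed. ring.
Qed.

Lemma viscous_layer_range (fm fp : R -> R) (uL uR M eps : R) (U V w : R -> R) (y : R) :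
  viscous_layer fm fp uL uR M eps U V w ->
  Rmin uL uR <= U y <= Rmax uL uR /\ -1 <= V y <= 1.
Proof.
intros [_ LU [wV LV]]. split.
- exact (layer_range _ _ _ _ _ _ y LU).
- generalize (layer_range _ _ _ _ _ _ y LV). rewrite Rmin_left, Rmax_right by lra. easy.
Qed.

(** The mixed speed and the term [eps * y] are each at most [M]. *)
Lemma viscous_layer_drift_bound (fm fp : R -> R) (uL uR M K eps : R) (U V w : R -> R) (y : R) :
  speed_bounds fm fp (Rmin uL uR) (Rmax uL uR) M K ->
  viscous_layer fm fp uL uR M eps U V w -> - (M / eps) <= y <= M / eps ->
  Rabs (mixed_speed fm fp (U y) (V y) - eps * y) <= 2 * M.
Proof.
intros B L Hy.
destruct (viscous_layer_range _ _ _ _ _ _ _ _ _ y L) as [HU HV].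
generalize (mixed_speed_bound _ _ _ _ _ _ _ _ B HU HV). intros H1.
apply scale_le in Hy; [|apply (vl_eps L)].
apply Rabs_le_between in H1. apply Rabs_le_between. lra.
Qed.

Definition slope_bound (uL uR M d : R) : R := Rabs (uR - uL) / d * exp (2 * M * d).

Lemma viscous_layer_slope_bound (fm fp : R -> R) (uL uR M K eps : R) (U V w : R -> R) (d y : R) :
  speed_bounds fm fp (Rmin uL uR) (Rmax uL uR) M K ->
  viscous_layer fm fp uL uR M eps U V w ->
  0 < d <= M / eps -> - (M / eps) <= y <= M / eps ->
  Rabs (w y) <= slope_bound uL uR M d.
Proof.
intros B L Hd Hy.
apply (layer_gradient_bound _ _ _ _ _ _ _ _ _ (vl_U L)); try assumption.
intros z Hz. eapply viscous_layer_drift_bound; eassumption.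
Qed.

(** Here [D] and [P] are the differences of two states and of their slopes, and the left side is
    the derivative of [D ^ 2 + P ^ 2]. Writing [a1 w1 - a2 w2 = a1 P + w2 (a1 - a2)] bounds it
    by the same quantity up to the error [c] in the drifts. *)
Lemma energy_rate_bound (D P a1 a2 w1 w2 M L K c : R) :
  Rabs a1 <= 2 * M -> Rabs w2 <= L -> 0 <= K -> 0 <= c -> P = w1 - w2 ->
  Rabs (a1 - a2) <= K * Rabs D + c ->
  Rabs (2 * D * P + 2 * P * (a1 * w1 - a2 * w2))
  <= (2 + 4 * M + L * K) * (D ^ 2 + P ^ 2) + (L * c) ^ 2.
Proof.
intros Ha Hw HK Hc HP Hd.
replace (a1 * w1 - a2 * w2) with (a1 * P + w2 * (a1 - a2)) by (rewrite HP; ring).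
clear HP.
replace (2 * D * P + 2 * P * (a1 * P + w2 * (a1 - a2)))
  with (2 * D * P + (2 * a1 * P ^ 2 + 2 * (P * (w2 * (a1 - a2))))) by ring.
assert (HL : 0 <= L) by (apply Rle_trans with (2 := Hw), Rabs_pos).
assert (T1 : Rabs (2 * D * P) <= D ^ 2 + P ^ 2).
{ apply Rabs_le_between. generalize (pow2_ge_0 (D + P)) (pow2_ge_0 (D - P)). lra. }
assert (T2 : Rabs (2 * a1 * P ^ 2) <= 4 * M * P ^ 2).
{ rewrite Rabs_mult, (Rabs_pos_eq (P ^ 2)) by apply pow2_ge_0.
  apply Rmult_le_compat_r; [apply pow2_ge_0|].
  rewrite Rabs_mult, (Rabs_pos_eq 2) by lra. lra. }
assert (T3 : Rabs (P * (w2 * (a1 - a2))) <= Rabs P * (L * (K * Rabs D + c))).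
{ rewrite !Rabs_mult. apply Rmult_le_compat_l; [apply Rabs_pos|].
  apply Rmult_le_compat; try assumption; apply Rabs_pos. }
assert (T4 : 2 * (Rabs P * (L * (K * Rabs D + c)))
    <= L * K * (D ^ 2 + P ^ 2) + P ^ 2 + (L * c) ^ 2).
{ rewrite <- (pow2_abs D), <- (pow2_abs P). generalize (Rabs D) (Rabs P). intros x y.
  assert (LK : 0 <= L * K) by now apply Rmult_le_pos.
  generalize (pow2_ge_0 (y - L * c)) (Rmult_le_pos _ _ LK (pow2_ge_0 (x - y))).
  intros. lra. }
apply Rle_trans with (1 := Rabs_triang _ _).
apply Rle_trans with (Rabs (2 * D * P) + (Rabs (2 * a1 * P ^ 2) + Rabs (2 * (P * (w2 * (a1 - a2)))))).
{ apply Rplus_le_compat_l, Rabs_triang. }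
rewrite (Rabs_mult 2 (P * _)), (Rabs_pos_eq 2) by lra.
assert (HM : 0 <= M) by (generalize (Rabs_pos a1); lra).
generalize (pow2_ge_0 D) (Rmult_le_pos _ _ HM (pow2_ge_0 D)). intros. lra.
Qed.

(** Gronwall's inequality for the squared distance in the phase plane of state and slope; the
    drifts differ by a Lipschitz term in the states plus the errors in [V] and in [eps]. *)
Lemma viscous_layer_stability (fm fp : R -> R) (uL uR M K e1 e2 : R) (U1 V1 w1 U2 V2 w2 : R -> R)
    (L r eta y : R) :
  speed_bounds fm fp (Rmin uL uR) (Rmax uL uR) M K -> 0 <= M ->
  viscous_layer fm fp uL uR M e1 U1 V1 w1 ->
  viscous_layer fm fp uL uR M e2 U2 V2 w2 ->
  r <= M / e1 -> r <= M / e2 ->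
  (forall z, - r < z < r -> Rabs (w2 z) <= L) ->
  (forall z, - r < z < r -> Rabs (V1 z - V2 z) <= eta) ->
  Rabs (e1 - e2) <= eta ->
  - r < y < r ->
  (U1 y - U2 y) ^ 2 + (w1 y - w2 y) ^ 2
  <= ((U1 0 - U2 0) ^ 2 + (w1 0 - w2 0) ^ 2 + (L * ((M + r) * eta)) ^ 2 * r)
     * exp ((2 + 4 * M + L * K) * r).
Proof.
intros B HM L1 L2 Hr1 Hr2 Hw HV He Hy.
set (a1 := fun y => mixed_speed fm fp (U1 y) (V1 y) - e1 * y).
set (a2 := fun y => mixed_speed fm fp (U2 y) (V2 y) - e2 * y).
set (E := fun y => (U1 y - U2 y) ^ 2 + (w1 y - w2 y) ^ 2).
set (dE := fun y => 2 * (U1 y - U2 y) * (w1 y - w2 y)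
    + 2 * (w1 y - w2 y) * (a1 y * w1 y - a2 y * w2 y)).
assert (HL : 0 <= L) by (apply Rle_trans with (2 := Hw y Hy), Rabs_pos).
assert (Heta : 0 <= eta) by (apply Rle_trans with (2 := He), Rabs_pos).
assert (HLK : 0 <= L * K) by (apply Rmult_le_pos; [assumption | apply (sb_nonneg B)]).
assert (G : E y <= (E 0 + (L * ((M + r) * eta)) ^ 2 * Rabs y) * exp ((2 + 4 * M + L * K) * Rabs y)).
{ apply (gronwall E dE _ _ r).
  - lra.
  - apply pow2_ge_0.
  - intros z Hz.
    assert (D1 : is_derive U1 z (w1 z)) by (apply (layer_derive (vl_U L1)); lra).
    assert (D2 : is_derive U2 z (w2 z)) by (apply (layer_derive (vl_U L2)); lra).
    generalize (layer_slope_derive _ _ _ _ _ _ z (vl_U L1))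
      (layer_slope_derive _ _ _ _ _ _ z (vl_U L2)). intros D3 D4.
    unfold E, dE. auto_derive; [repeat split; eexists; eassumption|].
    rewrite (is_derive_unique (fun t : R => U1 t) _ _ D1), (is_derive_unique (fun t : R => U2 t) _ _ D2),
      (is_derive_unique (fun t : R => w1 t) _ _ D3), (is_derive_unique (fun t : R => w2 t) _ _ D4).
    unfold a1, a2. ring.
  - intros z Hz.
    destruct (viscous_layer_range _ _ _ _ _ _ _ _ _ z L1) as [HU1 HV1].
    destruct (viscous_layer_range _ _ _ _ _ _ _ _ _ z L2) as [HU2 HV2].
    apply energy_rate_bound; try easy.
    + apply (viscous_layer_drift_bound _ _ _ _ _ _ _ _ _ _ _ B L1). lra.
    + now apply Hw.
    + apply (sb_nonneg B).
    + apply Rmult_le_pos; lra.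
    + unfold a1, a2.
      replace (mixed_speed fm fp (U1 z) (V1 z) - e1 * z - (mixed_speed fm fp (U2 z) (V2 z) - e2 * z))
        with (mixed_speed fm fp (U1 z) (V1 z) - mixed_speed fm fp (U2 z) (V2 z) - (e1 - e2) * z) by ring.
      apply Rle_trans with (1 := Rabs_triang _ _). rewrite Rabs_Ropp, Rabs_mult.
      assert (Hz' : Rabs z <= r) by (apply Rabs_le_between; lra).
      generalize (mixed_speed_lipschitz _ _ _ _ _ _ (U1 z) (V1 z) _ (V2 z) B HU2 HV1)
        (Rmult_le_compat_l M _ _ HM (HV z Hz))
        (Rmult_le_compat _ _ _ _ (Rabs_pos _) (Rabs_pos _) He Hz'). lra.
  - exact Hy. }
assert (Hy' : Rabs y <= r) by (apply Rabs_le_between; lra).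
fold (E y). apply Rle_trans with (1 := G). fold (E 0).
apply Rmult_le_compat.
- apply Rplus_le_le_0_compat.
  + unfold E. generalize (pow2_ge_0 (U1 0 - U2 0)) (pow2_ge_0 (w1 0 - w2 0)). lra.
  + apply Rmult_le_pos; [apply pow2_ge_0 | apply Rabs_pos].
- left. apply exp_pos.
- apply Rplus_le_compat_l. apply Rmult_le_compat_l; [apply pow2_ge_0 | assumption].
- apply exp_monotone. apply Rmult_le_compat_l; lra.
Qed.

(** * Compactness of families of layers *)

Definition locally_uniformly_cauchy (fn : nat -> R -> R) : Prop :=
  forall r eta : R, 0 < r -> 0 < eta ->
    exists N : nat, forall n k : nat, (N <= n)%nat -> (N <= k)%nat ->
      forall y, - r < y < r -> Rabs (fn n y - fn k y) <= eta.

Definition locally_uniform_limit (fn : nat -> R -> R) (f : R -> R) : Prop :=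
  forall r eta : R, 0 < r -> 0 < eta ->
    eventually (fun n => forall y, - r < y < r -> Rabs (fn n y - f y) <= eta).

Lemma locally_uniform_limit_pointwise (fn : nat -> R -> R) (f : R -> R) (y : R) :
  locally_uniform_limit fn f -> is_lim_seq (fun n => fn n y) (f y).
Proof.
intros H. apply is_lim_seq_spec. intros eps.
generalize (Rabs_pos y). intros Hp.
destruct (H (Rabs y + 1) (eps / 2)) as [N HN].
- lra.
- apply is_pos_div_2.
- exists N. intros n Hn. apply Rle_lt_trans with (eps / 2).
  + apply HN; [assumption|]. apply Rabs_lt_between. lra.
  + generalize (cond_pos eps). lra.
Qed.

Lemma locally_uniformly_cauchy_limit (fn : nat -> R -> R) :
  locally_uniformly_cauchy fn -> exists f, locally_uniform_limit fn f.
Proof.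
intros H.
set (f := fun y => real (Lim_seq (fun n => fn n y))).
assert (P : forall y, is_lim_seq (fun n => fn n y) (f y)).
{ intros y. apply Lim_seq_correct', ex_lim_seq_cauchy_corr. intros eps.
  generalize (Rabs_pos y). intros Hp.
  destruct (H (Rabs y + 1) (eps / 2)) as [N HN].
  - lra.
  - apply is_pos_div_2.
  - exists N. intros n k Hn Hk. apply Rle_lt_trans with (eps / 2).
    + apply HN; try assumption. apply Rabs_lt_between. lra.
    + generalize (cond_pos eps). lra. }
exists f. intros r eta Hr Heta.
destruct (H r eta Hr Heta) as [N HN]. exists N. intros n Hn y Hy.
assert (L : is_lim_seq (fun k => Rabs (fn n y - fn k y)) (Rabs (fn n y - f y))).
{ apply (is_lim_seq_abs _ (Finite (fn n y - f y))).
  apply is_lim_seq_minus'; [apply is_lim_seq_const | apply P]. }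
refine (is_lim_seq_le_loc _ _ _ (Finite _) _ L (is_lim_seq_const eta)).
exists N. intros k Hk. now apply HN.
Qed.

Lemma is_lim_seq_eventually (s : nat -> R) (l d : R) :
  is_lim_seq s l -> 0 < d -> eventually (fun n => Rabs (s n - l) < d).
Proof.
intros H Hd. apply is_lim_seq_spec in H. exact (H (mkposreal d Hd)).
Qed.

Lemma gauss_small (M d : R) : 0 < M -> 0 < d ->
  exists e0, 0 < e0 /\ forall e, 0 < e < e0 -> gauss (M / e) < d.
Proof.
intros HM Hd.
assert (HM2 : 0 < d * (M * M) / 2) by (apply Rdiv_lt_0_compat; [apply Rmult_lt_0_compat; nra | lra]).
exists (Rmin 1 (d * (M * M) / 2)). split; [apply Rmin_pos; lra|].
intros e He.
assert (H1 : e < 1) by (apply Rlt_le_trans with (1 := proj2 He), Rmin_l).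
assert (H2 : e < d * (M * M) / 2) by (apply Rlt_le_trans with (1 := proj2 He), Rmin_r).
set (t := (M / e) ^ 2 / 2).
assert (Ht : t * (2 * (e * e)) = M * M) by (unfold t; field; lra).
assert (Ht0 : 0 < t).
{ unfold t. apply Rdiv_lt_0_compat; [|lra]. apply pow_lt, Rdiv_lt_0_compat; lra. }
unfold gauss. fold t. rewrite exp_Ropp.
apply Rlt_trans with (/ t).
- apply Rinv_lt_contravar; [apply Rmult_lt_0_compat; [assumption | apply exp_pos]|].
  generalize (exp_ineq1 t ltac:(lra)). lra.
- apply Rmult_lt_reg_l with t; [assumption|]. rewrite Rinv_r by lra.
  assert (Hed : e * e < d * (M * M) / 2) by nra.
  apply Rmult_lt_compat_l with (r := t) in Hed; [|assumption]. nra.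
Qed.

Lemma eventually_width (M r : R) (e : nat -> R) :
  0 < M -> 0 < r -> vanishing e -> eventually (fun n => r <= M / e n).
Proof.
intros HM Hr [He0 He].
generalize (is_lim_seq_eventually e 0 (M / r) He (Rdiv_lt_0_compat _ _ HM Hr)).
apply filter_imp. intros n Hn.
rewrite Rminus_0_r, Rabs_pos_eq in Hn by (left; apply He0).
apply Rmult_le_reg_r with (e n); [apply He0|].
replace (M / e n * e n) with M by (field; apply Rgt_not_eq, He0).
apply Rmult_lt_compat_l with (r := r) in Hn; [|assumption].
replace (r * (M / r)) with M in Hn by (field; lra). lra.
Qed.

Lemma gaussian_layers_uniform (fm fp : R -> R) (uL uR M d : R) (e : nat -> R) (Un Vn wn : nat -> R -> R) :
  0 < M -> 0 < d -> vanishing e ->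
  (forall n, viscous_layer fm fp uL uR M (e n) (Un n) (Vn n) (wn n)) ->
  eventually (fun n => forall y, Rabs (Vn n y - Vlim y) <= d).
Proof.
intros HM Hd [He0 He] HL.
destruct (gauss_small M d HM Hd) as [e0 [He0' Hg]].
generalize (is_lim_seq_eventually e 0 e0 He He0').
apply filter_imp. intros n Hn y.
rewrite Rminus_0_r, Rabs_pos_eq in Hn by (left; apply He0).
destruct (vl_V (HL n)) as [wV LV].
apply Rle_trans with (1 := gaussian_layer_error _ _ _ y LV).
left. apply Hg. split; [apply He0 | assumption].
Qed.

Lemma vanishing_width (M : R) (e : nat -> R) :
  0 < M -> vanishing e -> exists d, 0 < d /\ forall n, d <= M / e n.
Proof.
intros HM [He0 He].
destruct (maj_by_pos e) as [l [Hl Hb]].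
{ exists 0. now apply is_lim_seq_Reals. }
exists (M / l). split; [now apply Rdiv_lt_0_compat|].
intros n. apply Rmult_le_compat_l; [lra|].
apply Rinv_le_contravar; [apply He0|].
apply Rle_trans with (2 := Hb n), Rle_abs.
Qed.

Lemma Rabs_le_of_sqr (x c : R) : 0 <= c -> x ^ 2 <= c ^ 2 -> Rabs x <= c.
Proof.
intros Hc H. rewrite <- (Rabs_pos_eq c Hc). apply Rsqr_le_abs_0. unfold Rsqr. lra.
Qed.

(** Convergence of the two data at the origin suffices: the stability estimate propagates it to
    every compact set, with a constant common to all the layers of the sequence. *)
Lemma viscous_layers_cauchy (fm fp : R -> R) (uL uR M K alpha beta : R)
    (e : nat -> R) (Un Vn wn : nat -> R -> R) :
  speed_bounds fm fp (Rmin uL uR) (Rmax uL uR) M K -> 0 < M -> vanishing e ->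
  (forall n, viscous_layer fm fp uL uR M (e n) (Un n) (Vn n) (wn n)) ->
  is_lim_seq (fun n => Un n 0) alpha -> is_lim_seq (fun n => wn n 0) beta ->
  locally_uniformly_cauchy Un /\ locally_uniformly_cauchy wn.
Proof.
intros B HM He HL Ha Hb.
destruct (vanishing_width M e HM He) as [d0 [Hd0 Hw]].
set (L := slope_bound uL uR M d0).
assert (HK : 0 <= K) by apply (sb_nonneg B).
assert (S : forall n y, - (M / e n) <= y <= M / e n -> Rabs (wn n y) <= L).
{ intros n y Hy. eapply viscous_layer_slope_bound; [exact B | apply HL | split; [assumption|apply Hw] | exact Hy]. }
assert (L0 : 0 <= L).
{ apply Rle_trans with (1 := Rabs_pos (wn O 0)), S. generalize (Hw O). lra. }
enough (G : forall r eta : R, 0 < r -> 0 < eta ->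
    exists N : nat, forall n k : nat, (N <= n)%nat -> (N <= k)%nat ->
      forall y, - r < y < r ->
       (Un n y - Un k y) ^ 2 + (wn n y - wn k y) ^ 2 <= eta ^ 2).
{ split; intros r eta Hr Heta; destruct (G r eta Hr Heta) as [N HN]; exists N;
    intros n k Hn Hk y Hy; specialize (HN n k Hn Hk y Hy); apply Rabs_le_of_sqr; try lra.
  - generalize (pow2_ge_0 (wn n y - wn k y)). lra.
  - generalize (pow2_ge_0 (Un n y - Un k y)). lra. }
intros r eta Hr Heta.
set (C := (2 + 4 * M + L * K) * r).
assert (HC : 0 <= C).
{ apply Rmult_le_pos; [|lra]. generalize (Rmult_le_pos _ _ L0 HK). lra. }
set (Q := 2 + (L * (M + r)) ^ 2 * r).
assert (HQ : 2 <= Q).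
{ unfold Q. generalize (Rmult_le_pos _ _ (pow2_ge_0 (L * (M + r))) (Rlt_le _ _ Hr)). lra. }
(* At this closeness of all data, the stability bound [dl ^ 2 * Q * exp C] is at most
   [eta ^ 2]. *)
set (dl := eta * exp (- C) / Q).
assert (Hdl : 0 < dl).
{ apply Rdiv_lt_0_compat; [apply Rmult_lt_0_compat; [assumption|apply exp_pos] | lra]. }
assert (Hfin : dl ^ 2 * Q * exp C <= eta ^ 2).
{ replace (dl ^ 2 * Q * exp C) with (eta ^ 2 * (exp (- C) * / Q)).
  - rewrite <- (Rmult_1_r (eta ^ 2)) at 2. apply Rmult_le_compat_l; [apply pow2_ge_0|].
    rewrite <- (Rmult_1_r 1). apply Rmult_le_compat.
    + left; apply exp_pos.
    + left; apply Rinv_0_lt_compat; lra.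
    + rewrite <- exp_0. apply exp_monotone. lra.
    + rewrite <- Rinv_1. apply Rinv_le_contravar; lra.
  - unfold dl. assert (EE : exp (- C) * exp C = 1) by (rewrite <- exp_plus, Rplus_opp_l; apply exp_0).
    replace ((eta * exp (- C) / Q) ^ 2 * Q * exp C)
      with (eta ^ 2 * (exp (- C) * / Q) * (exp (- C) * exp C)) by (field; lra).
    rewrite EE. ring. }
destruct (@filter_and nat eventually _ _ _
  (@filter_and nat eventually _ _ _ (is_lim_seq_eventually _ _ (dl / 2) Ha ltac:(lra))
                  (is_lim_seq_eventually _ _ (dl / 2) Hb ltac:(lra)))
  (@filter_and nat eventually _ _ _ (@filter_and nat eventually _ _ _ (is_lim_seq_eventually _ _ (dl / 2) (proj2 He) ltac:(lra))
                                  (eventually_width M r e HM Hr He))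
                  (gaussian_layers_uniform _ _ _ _ _ (dl / 2) _ _ _ _ HM ltac:(lra) He HL))) as [N HN].
exists N. intros n k Hn Hk y Hy.
destruct (HN n Hn) as [[Un0 wn0] [[en rn] Vn0]].
destruct (HN k Hk) as [[Uk0 wk0] [[ek rk] Vk0]].
eapply Rle_trans.
{ apply (viscous_layer_stability _ _ _ _ _ _ _ _ _ _ _ _ _ _ L r dl y B (Rlt_le _ _ HM) (HL n) (HL k) rn rk).
  - intros z Hz. apply S. lra.
  - intros z Hz. generalize (Vn0 z) (Vk0 z).
    rewrite !Rabs_le_between. lra.
  - apply Rabs_lt_between in en. apply Rabs_lt_between in ek. apply Rabs_le_between. lra.
  - exact Hy. }
fold C. apply Rle_trans with (2 := Hfin).
apply Rmult_le_compat_r; [left; apply exp_pos|].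
apply Rabs_lt_between in Un0, wn0, Uk0, wk0.
assert (Q1 : (Un n 0 - Un k 0) ^ 2 <= dl ^ 2).
{ apply pow_maj_Rabs. apply Rabs_le_between. lra. }
assert (Q2 : (wn n 0 - wn k 0) ^ 2 <= dl ^ 2).
{ apply pow_maj_Rabs. apply Rabs_le_between. lra. }
replace ((L * ((M + r) * dl)) ^ 2 * r) with (dl ^ 2 * ((L * (M + r)) ^ 2 * r)) by ring.
unfold Q. lra.
Qed.

Record viscous_profile (fm fp : R -> R) (lo hi : R) (U W : R -> R) : Prop := {
  vp_range : forall y, lo <= U y <= hi;
  vp_slope : forall y, is_derive U y (W y);
  vp_ode : forall y, is_derive W y (mixed_speed fm fp (U y) (Vlim y) * W y)
}.

Arguments vp_range {fm fp lo hi U W}.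
Arguments vp_slope {fm fp lo hi U W}.
Arguments vp_ode {fm fp lo hi U W}.

Lemma derive_bound_lipschitz (f df : R -> R) (m B x y : R) :
  (forall z, - m < z < m -> is_derive f z (df z) /\ Rabs (df z) <= B) ->
  - m < x < m -> - m < y < m -> Rabs (f y - f x) <= B * Rabs (y - x).
Proof.
intros H Hx Hy.
assert (I : forall z, Rmin x y <= z <= Rmax x y -> - m < z < m).
{ intros z. unfold Rmin, Rmax. destruct (Rle_dec x y); lra. }
destruct (MVT_gen f x y df) as [c [Hc E]].
- intros z Hz. apply H, I. lra.
- intros z Hz. apply continuity_pt_filterlim.
  apply (is_derive_continuous _ _ (df z)), H, I. lra.
- rewrite E, Rabs_mult. apply Rmult_le_compat_r; [apply Rabs_pos|].
  now apply H, I.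
Qed.

(** Lipschitz constants of the slope and of its derivative that depend on [eps] only through a
    lower bound [d] of the width of the layer, as [derive_of_limit] requires. *)
Lemma viscous_layer_acceleration_lipschitz (fm fp : R -> R) (uL uR M K eps : R) (U V w : R -> R)
    (d x y : R) :
  speed_bounds fm fp (Rmin uL uR) (Rmax uL uR) M K -> 0 < M ->
  viscous_layer fm fp uL uR M eps U V w -> 0 < d <= M / eps ->
  - (M / eps) < x < M / eps -> - (M / eps) < y < M / eps ->
  let L := slope_bound uL uR M d in
  let a := fun z => mixed_speed fm fp (U z) (V z) - eps * z in
  Rabs (w y - w x) <= 2 * M * L * Rabs (y - x) /\
  Rabs (a y * w y - a x * w x)
  <= (2 * M * (2 * M * L) + L * (K * L + M * / gauss_area d + M / d)) * Rabs (y - x).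
Proof.
intros B HM HL Hd Hx Hy L a.
assert (Sw : forall z, - (M / eps) < z < M / eps -> Rabs (w z) <= L).
{ intros z Hz. eapply viscous_layer_slope_bound; try eassumption. lra. }
assert (Sa : forall z, - (M / eps) < z < M / eps -> Rabs (a z) <= 2 * M).
{ intros z Hz. eapply viscous_layer_drift_bound; try eassumption. lra. }
assert (L0 : 0 <= L) by (apply Rle_trans with (2 := Sw x Hx), Rabs_pos).
assert (LU : Rabs (U y - U x) <= L * Rabs (y - x)).
{ apply (derive_bound_lipschitz U w (M / eps)); try assumption.
  intros z Hz. split; [|now apply Sw].
  now apply (layer_derive (vl_U HL)). }
assert (Lw : Rabs (w y - w x) <= 2 * M * L * Rabs (y - x)).
{ apply (derive_bound_lipschitz w (fun z => a z * w z) (M / eps)); try assumption.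
  intros z Hz. split.
  - apply (layer_slope_derive _ _ _ _ _ _ z (vl_U HL)).
  - rewrite Rabs_mult. apply Rmult_le_compat; try apply Rabs_pos; auto. }
split; [exact Lw|].
assert (LV : Rabs (V y - V x) <= / gauss_area d * Rabs (y - x)).
{ destruct (vl_V HL) as [wV G].
  eapply Rle_trans; [apply (gaussian_layer_lipschitz _ _ _ x y G); lra|].
  apply Rmult_le_compat_r; [apply Rabs_pos|].
  apply Rinv_le_contravar; [apply gauss_area_pos; lra|].
  apply gauss_area_nondecreasing. lra. }
assert (He : 0 < eps <= M / d).
{ generalize (vl_eps HL). intros He. split; [assumption|].
  apply Rmult_le_reg_r with (d / eps); [apply Rdiv_lt_0_compat; lra|].
  replace (eps * (d / eps)) with d by (field; lra).
  replace (M / d * (d / eps)) with (M / eps) by (field; lra). lra. }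
destruct (viscous_layer_range _ _ _ _ _ _ _ _ _ x HL) as [HUx HVx].
destruct (viscous_layer_range _ _ _ _ _ _ _ _ _ y HL) as [HUy HVy].
assert (La : Rabs (a y - a x) <= (K * L + M * / gauss_area d + M / d) * Rabs (y - x)).
{ unfold a.
  replace (mixed_speed fm fp (U y) (V y) - eps * y - (mixed_speed fm fp (U x) (V x) - eps * x))
    with (mixed_speed fm fp (U y) (V y) - mixed_speed fm fp (U x) (V x) - eps * (y - x)) by ring.
  apply Rle_trans with (1 := Rabs_triang _ _). rewrite Rabs_Ropp, Rabs_mult, (Rabs_pos_eq eps) by lra.
  generalize (mixed_speed_lipschitz _ _ _ _ _ _ (U y) (V y) _ (V x) B HUx HVy)
    (Rmult_le_compat_l K _ _ (sb_nonneg B) LU)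
    (Rmult_le_compat_l M _ _ (Rlt_le _ _ HM) LV)
    (Rmult_le_compat_r _ _ _ (Rabs_pos (y - x)) (proj2 He)). lra. }
replace (a y * w y - a x * w x) with (a y * (w y - w x) + w x * (a y - a x)) by ring.
apply Rle_trans with (1 := Rabs_triang _ _). rewrite !Rabs_mult.
generalize (Rmult_le_compat _ _ _ _ (Rabs_pos _) (Rabs_pos _) (Sa y Hy) Lw)
  (Rmult_le_compat _ _ _ _ (Rabs_pos _) (Rabs_pos _) (Sw x Hx) La). lra.
Qed.

Lemma viscous_layers_converge (fm fp : R -> R) (uL uR M K alpha beta : R)
    (e : nat -> R) (Un Vn wn : nat -> R -> R) :
  speed_bounds fm fp (Rmin uL uR) (Rmax uL uR) M K -> 0 < M -> vanishing e ->
  (forall n, viscous_layer fm fp uL uR M (e n) (Un n) (Vn n) (wn n)) ->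
  is_lim_seq (fun n => Un n 0) alpha -> is_lim_seq (fun n => wn n 0) beta ->
  exists U W, locally_uniform_limit Un U /\ locally_uniform_limit wn W /\
    viscous_profile fm fp (Rmin uL uR) (Rmax uL uR) U W /\
    (uL <= uR -> nondecreasing U) /\ (uR <= uL -> nonincreasing U).
Proof.
intros B HM He HL Ha Hb.
destruct (viscous_layers_cauchy _ _ _ _ _ _ _ _ _ _ _ _ B HM He HL Ha Hb) as [CU CW].
destruct (locally_uniformly_cauchy_limit _ CU) as [U HU].
destruct (locally_uniformly_cauchy_limit _ CW) as [W HW].
exists U, W. split; [assumption|split; [assumption|]].
assert (PU : forall y, is_lim_seq (fun n => Un n y) (U y))
  by (intros; now apply locally_uniform_limit_pointwise).
assert (PW : forall y, is_lim_seq (fun n => wn n y) (W y))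
  by (intros; now apply locally_uniform_limit_pointwise).
assert (PV : forall y, is_lim_seq (fun n => Vn n y) (Vlim y)).
{ intros y. apply is_lim_seq_spec. intros d.
  generalize (gaussian_layers_uniform _ _ _ _ _ (d / 2) _ _ _ _ HM (is_pos_div_2 d) He HL).
  apply filter_imp. intros n Hn. apply Rle_lt_trans with (1 := Hn y).
  generalize (cond_pos d). lra. }
assert (PA : forall y, is_lim_seq (fun n => mixed_speed fm fp (Un n y) (Vn n y) - e n * y)
                        (mixed_speed fm fp (U y) (Vlim y))).
{ intros y.
  assert (P1 : is_lim_seq (fun n => Derive fm (Un n y)) (Derive fm (U y))).
  { apply is_lim_seq_continuous; [|apply PU]. apply continuity_pt_filterlim.
    eapply speed_continuous_m, B. }
  assert (P2 : is_lim_seq (fun n => Derive fp (Un n y)) (Derive fp (U y))).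
  { apply is_lim_seq_continuous; [|apply PU]. apply continuity_pt_filterlim.
    eapply speed_continuous_p, B. }
  replace (mixed_speed fm fp (U y) (Vlim y)) with (mixed_speed fm fp (U y) (Vlim y) - 0 * y) by ring.
  unfold mixed_speed.
  apply is_lim_seq_minus'; [apply is_lim_seq_mult'; [apply is_lim_seq_const|apply is_lim_seq_plus']|].
  - apply is_lim_seq_mult'; [|assumption].
    apply is_lim_seq_minus'; [apply is_lim_seq_const | apply PV].
  - apply is_lim_seq_mult'; [|assumption].
    apply is_lim_seq_plus'; [apply is_lim_seq_const | apply PV].
  - apply is_lim_seq_mult'; [apply He | apply is_lim_seq_const]. }
destruct (vanishing_width M e HM He) as [d [Hd Hdn]].
assert (Near : forall y, eventually (fun n => forall z, y - 1 < z < y + 1 -> - (M / e n) < z < M / e n)).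
{ intros y. generalize (eventually_width M (Rabs y + 1) e HM ltac:(generalize (Rabs_pos y); lra) He).
  apply filter_imp. intros n Hn z Hz.
  generalize (Rle_abs y) (Rle_abs (- y)). rewrite Rabs_Ropp. lra. }
split; [split|split].
- intros y. split.
  + refine (is_lim_seq_le _ _ (Finite _) (Finite _) _ (is_lim_seq_const (Rmin uL uR)) (PU y)).
    intros n. apply (viscous_layer_range _ _ _ _ _ _ _ _ _ y (HL n)).
  + refine (is_lim_seq_le _ _ (Finite _) (Finite _) _ (PU y) (is_lim_seq_const (Rmax uL uR))).
    intros n. apply (viscous_layer_range _ _ _ _ _ _ _ _ _ y (HL n)).
- intros y.
  apply (derive_of_limit U W Un wn y 1 (2 * M * slope_bound uL uR M d)); [lra| |intros; apply PU|apply PW].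
  generalize (Near y). apply filter_imp. intros n Hn z Hz. split.
  + apply (layer_derive (vl_U (HL n))). now apply Hn.
  + refine (proj1 (viscous_layer_acceleration_lipschitz _ _ _ _ _ _ _ _ _ _ d y z B HM (HL n) _ _ _));
      [split; auto | apply Hn; lra | now apply Hn].
- intros y.
  apply (derive_of_limit W (fun y => mixed_speed fm fp (U y) (Vlim y) * W y) wn
    (fun n z => (mixed_speed fm fp (Un n z) (Vn n z) - e n * z) * wn n z) y 1
    (2 * M * (2 * M * slope_bound uL uR M d)
     + slope_bound uL uR M d * (K * slope_bound uL uR M d + M * / gauss_area d + M / d)));
    [lra| |intros; apply PW|apply is_lim_seq_mult'; [apply PA | apply PW]].
  generalize (Near y). apply filter_imp. intros n Hn z Hz. split.
  + apply (layer_slope_derive _ _ _ _ _ _ _ (vl_U (HL n))).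
  + refine (proj2 (viscous_layer_acceleration_lipschitz _ _ _ _ _ _ _ _ _ _ d y z B HM (HL n) _ _ _));
      [split; auto | apply Hn; lra | now apply Hn].
- intros H x y Hxy.
  refine (is_lim_seq_le _ _ (Finite _) (Finite _) _ (PU x) (PU y)).
  intros n. now apply (layer_nondecreasing _ _ _ _ _ _ (vl_U (HL n))).
- intros H x y Hxy.
  refine (is_lim_seq_le _ _ (Finite _) (Finite _) _ (PU y) (PU x)).
  intros n. now apply (layer_nonincreasing _ _ _ _ _ _ (vl_U (HL n))).
Qed.

Lemma vanishing_extraction (e : nat -> R) (phi : nat -> nat) :
  extraction phi -> vanishing e -> vanishing (fun n => e (phi n)).
Proof.
intros Hp [H0 H]. split; [intros; apply H0 | now apply is_lim_seq_extraction].
Qed.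

(** The data at the origin lie in a bounded set: the states are between [uL] and [uR], and the
    slopes are at most [slope_bound]. *)
Lemma viscous_layers_compact (fm fp : R -> R) (uL uR M K : R)
    (e : nat -> R) (Un Vn wn : nat -> R -> R) :
  speed_bounds fm fp (Rmin uL uR) (Rmax uL uR) M K -> 0 < M -> vanishing e ->
  (forall n, viscous_layer fm fp uL uR M (e n) (Un n) (Vn n) (wn n)) ->
  exists (phi : nat -> nat) (U W : R -> R), extraction phi /\
    locally_uniform_limit (fun n => Un (phi n)) U /\
    locally_uniform_limit (fun n => wn (phi n)) W /\
    viscous_profile fm fp (Rmin uL uR) (Rmax uL uR) U W /\
    (uL <= uR -> nondecreasing U) /\ (uR <= uL -> nonincreasing U).
Proof.
intros B HM He HL.
destruct (vanishing_width M e HM He) as [d [Hd Hdn]].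
destruct (bolzano_weierstrass_extraction (fun n => Un n 0) (Rabs (Rmin uL uR) + Rabs (Rmax uL uR)))
  as [phi [alpha [Hphi Ha]]].
{ intros n. generalize (proj1 (viscous_layer_range _ _ _ _ _ _ _ _ _ 0 (HL n))).
  intros. apply Rabs_le_between. split_Rabs; lra. }
destruct (bolzano_weierstrass_extraction (fun n => wn (phi n) 0) (slope_bound uL uR M d))
  as [psi [beta [Hpsi Hb]]].
{ intros n. eapply viscous_layer_slope_bound; [exact B | apply HL | split; auto |].
  generalize (Hdn (phi n)). lra. }
exists (fun n => phi (psi n)).
destruct (viscous_layers_converge fm fp uL uR M K alpha beta (fun n => e (phi (psi n)))
  (fun n => Un (phi (psi n))) (fun n => Vn (phi (psi n))) (fun n => wn (phi (psi n))))
  as [U [W H]]; try assumption.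
- apply (vanishing_extraction e (fun n => phi (psi n))); [now apply extraction_comp | assumption].
- intros n. apply HL.
- apply (is_lim_seq_extraction (fun n => Un (phi n) 0)); assumption.
- exists U, W. split; [now apply extraction_comp | exact H].
Qed.

Lemma continuous_abs_diff (f g : R -> R) (y : R) :
  continuous f y -> continuous g y -> continuous (fun z => Rabs (f z - g z)) y.
Proof.
intros Hf Hg. apply (continuous_comp (fun z => f z - g z) Rabs).
- now apply (@continuous_minus R_UniformSpace R_AbsRing R_NormedModule).
- apply continuous_Rabs.
Qed.

Lemma locally_uniform_L1loc (fn : nat -> R -> R) (f : R -> R) :
  (forall n y, continuous (fn n) y) -> (forall y, continuous f y) ->
  locally_uniform_limit fn f -> L1loc_lim fn f.
Proof.
intros Hn Hf HU a b Hab.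
assert (C : forall n y, continuous (fun z => Rabs (fn n z - f z)) y)
  by (intros; now apply continuous_abs_diff).
split.
- intros n. now apply ex_RInt_cont.
- apply is_lim_seq_spec. intros eps.
  set (r := Rabs a + Rabs b + 1).
  assert (Hr : 0 < r) by (unfold r; generalize (Rabs_pos a) (Rabs_pos b); lra).
  assert (Hd : 0 < eps / 2 / (b - a + 1)).
  { apply Rdiv_lt_0_compat; [apply is_pos_div_2 | lra]. }
  generalize (HU r _ Hr Hd). apply filter_imp. intros n H.
  rewrite Rminus_0_r.
  apply Rle_lt_trans with (eps / 2 / (b - a + 1) * Rabs (b - a)).
  + apply RInt_abs_le; [apply C|]. intros z Hz. rewrite Rabs_Rabsolu. apply H.
    unfold r. rewrite Rmin_left, Rmax_right in Hz by lra.
    generalize (Rle_abs b) (Rle_abs (- a)) (Rabs_pos a) (Rabs_pos b). rewrite Rabs_Ropp. lra.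
  + rewrite Rabs_pos_eq by lra.
    apply Rle_lt_trans with (eps / 2).
    * replace (eps / 2) with (eps / 2 / (b - a + 1) * (b - a + 1)) at 2 by (field; lra).
      apply Rmult_le_compat_l; lra.
    * generalize (cond_pos eps). lra.
Qed.

(** The integral of [|f - g|] over any interval is zero, so its continuous integrand, the
    derivative of that integral, is zero. *)
Lemma L1loc_lim_unique (fn : nat -> R -> R) (f g : R -> R) :
  (forall n y, continuous (fn n) y) -> (forall y, continuous f y) -> (forall y, continuous g y) ->
  L1loc_lim fn f -> L1loc_lim fn g -> forall y, f y = g y.
Proof.
intros Hn Hf Hg Lf Lg y.
set (h := fun z => Rabs (f z - g z)).
assert (Ch : forall z, continuous h z) by (intros; now apply continuous_abs_diff).
assert (Z : forall b, y - 1 <= b -> RInt h (y - 1) b = 0).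
{ intros b Hb. apply Rle_antisym.
  - destruct (Lf (y - 1) b Hb) as [If Pf]. destruct (Lg (y - 1) b Hb) as [Ig Pg].
    generalize (is_lim_seq_plus' _ _ _ _ Pf Pg). rewrite Rplus_0_r. intros P.
    refine (is_lim_seq_le _ _ (Finite _) (Finite _) _ (is_lim_seq_const (RInt h (y - 1) b)) P).
    intros n.
    rewrite <- (RInt_plus (fun z => Rabs (fn n z - f z)) (fun z => Rabs (fn n z - g z))) by auto.
    apply RInt_le; [assumption|now apply ex_RInt_cont| |].
    + apply (@ex_RInt_plus R_NormedModule); auto.
    + intros z _. unfold h.
      replace (f z - g z) with ((fn n z - g z) - (fn n z - f z)) by ring.
      apply Rle_trans with (1 := Rabs_triang _ _). rewrite Rabs_Ropp, Rplus_comm. apply Rle_refl.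
  - apply RInt_ge_0; [assumption|now apply ex_RInt_cont|]. intros z _. apply Rabs_pos. }
(* Starting the integral at [y - 1] makes it vanish on a neighbourhood of [y]. *)
assert (D : is_derive (RInt h (y - 1)) y 0).
{ apply is_derive_ext_loc with (fun _ => 0).
  - exists (mkposreal 1 Rlt_0_1). intros z Hz. symmetry. apply Z.
    change (Rabs (z - y) < 1) in Hz. apply Rabs_lt_between in Hz. lra.
  - apply (@is_derive_const R_AbsRing R_NormedModule). }
assert (E : h y = 0).
{ rewrite <- (is_derive_unique _ _ _ D). symmetry.
  apply is_derive_unique. now apply is_derive_primitive. }
unfold h in E. destruct (Req_dec (f y) (g y)) as [Q|Q]; [exact Q|].
exfalso. apply (Rabs_no_R0 (f y - g y)); lra.
Qed.

Lemma L1loc_lim_extraction (fn : nat -> R -> R) (f : R -> R) (phi : nat -> nat) :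
  extraction phi -> L1loc_lim fn f -> L1loc_lim (fun n => fn (phi n)) f.
Proof.
intros Hp H a b Hab. destruct (H a b Hab) as [H1 H2]. split.
- intros n. apply H1.
- apply (is_lim_seq_extraction (fun n => RInt (fun y => Rabs (fn n y - f y)) a b)); assumption.
Qed.

(** * Profiles on the whole line *)

Lemma profile_drift_continuous (fm fp : R -> R) (lo hi M K : R) (U W : R -> R) (y : R) :
  speed_bounds fm fp lo hi M K -> viscous_profile fm fp lo hi U W ->
  continuous (fun z => mixed_speed fm fp (U z) (Vlim z)) y.
Proof.
intros B P. eapply continuous_mixed_speed; [exact B| |apply continuous_Vlim].
eapply is_derive_continuous, (vp_slope P).
Qed.

Lemma profile_slope_from (fm fp : R -> R) (lo hi M K : R) (U W : R -> R) (x y : R) :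
  speed_bounds fm fp lo hi M K -> viscous_profile fm fp lo hi U W ->
  W y = W x * exp (RInt (fun z => mixed_speed fm fp (U z) (Vlim z)) x y).
Proof.
intros B P.
apply (linear_ode _ W (Rmin x y - 1) (Rmax x y + 1)).
- intros z. eapply profile_drift_continuous; eassumption.
- intros z _. apply (vp_ode P).
- generalize (Rmin_l x y) (Rmax_l x y). lra.
- generalize (Rmin_r x y) (Rmax_r x y). lra.
Qed.

Lemma profile_C2 (fm fp : R -> R) (lo hi M K : R) (U W : R -> R) :
  speed_bounds fm fp lo hi M K -> viscous_profile fm fp lo hi U W ->
  Ck 2 U /\ (forall y, Derive U y = W y) /\
  (forall y, Derive_n U 2 y = mixed_speed fm fp (U y) (Vlim y) * W y).
Proof.
intros B P.
assert (E1 : Derive U = W).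
{ apply functional_extensionality. intros y. apply is_derive_unique, (vp_slope P). }
assert (E2 : forall y, Derive_n U 2 y = mixed_speed fm fp (U y) (Vlim y) * W y).
{ intros y. change (Derive (Derive U) y = mixed_speed fm fp (U y) (Vlim y) * W y).
  rewrite E1. apply is_derive_unique, (vp_ode P). }
split; [|split; [now rewrite E1 | exact E2]].
intros j x Hj.
destruct j as [|[|[|j]]]; [| | |lia].
- split; [exact I|]. eapply is_derive_continuous, (vp_slope P).
- split.
  + eexists. apply (vp_slope P).
  + change (continuous (Derive U) x). rewrite E1.
    eapply is_derive_continuous, (vp_ode P).
- split.
  + change (ex_derive (Derive U) x). rewrite E1. eexists. apply (vp_ode P).
  + apply continuous_ext with (fun y => mixed_speed fm fp (U y) (Vlim y) * W y).
    { intros z. now rewrite E2. }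
    apply (@continuous_mult R_UniformSpace R_AbsRing).
    * eapply profile_drift_continuous; eassumption.
    * eapply is_derive_continuous, (vp_ode P).
Qed.

(** The slope at [y] is comparable, up to [exp M], to its value at a mean value point
    between [y] and [y + 1]; this is what turns convergence of [U] at infinity into decay of the slope. *)
Lemma profile_slope_le_increment (fm fp : R -> R) (lo hi M K : R) (U W : R -> R) (y : R) :
  speed_bounds fm fp lo hi M K -> viscous_profile fm fp lo hi U W ->
  Rabs (W y) <= exp M * Rabs (U (y + 1) - U y).
Proof.
intros B P.
destruct (mean_value U W y (y + 1)) as [c [Hc E]].
- lra.
- intros; apply (vp_slope P).
- intros; eapply is_derive_continuous, (vp_slope P).
- rewrite E. replace (y + 1 - y) with 1 by ring. rewrite Rmult_1_r.
  rewrite (profile_slope_from _ _ _ _ _ _ _ _ c y B P), Rabs_mult, Rmult_comm.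
  apply Rmult_le_compat_r; [apply Rabs_pos|].
  rewrite Rabs_pos_eq by (left; apply exp_pos). apply exp_monotone.
  apply Rle_trans with (1 := Rle_abs _).
  assert (HB : forall z, Rabs (mixed_speed fm fp (U z) (Vlim z)) <= M).
  { intros z. eapply mixed_speed_bound; [exact B | apply (vp_range P) | apply Vlim_bound]. }
  apply Rle_trans with (M * Rabs (y - c)).
  + apply RInt_abs_le; [|intros; apply HB].
    intros z. eapply profile_drift_continuous; eassumption.
  + rewrite <- (Rmult_1_r M) at 2. apply Rmult_le_compat_l.
    * apply Rle_trans with (2 := HB y), Rabs_pos.
    * apply Rabs_le_between. lra.
Qed.

Lemma profile_slope_limit (fm fp : R -> R) (lo hi M K : R) (U W : R -> R) (x : Rbar) (l : R) :
  speed_bounds fm fp lo hi M K -> viscous_profile fm fp lo hi U W ->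
  x = p_infty \/ x = m_infty -> is_lim U x l -> is_lim W x 0.
Proof.
intros B P Hx HU.
apply is_lim_spec in HU. apply is_lim_spec. intros eps.
assert (Hd : 0 < eps / 2 / exp M).
{ apply Rdiv_lt_0_compat; [apply is_pos_div_2 | apply exp_pos]. }
assert (Q : forall y, Rabs (U y - l) < eps / 2 / exp M -> Rabs (U (y + 1) - l) < eps / 2 / exp M ->
  Rabs (W y - 0) < eps).
{ intros y H1 H2. rewrite Rminus_0_r.
  apply Rle_lt_trans with (1 := profile_slope_le_increment _ _ _ _ _ _ _ _ y B P).
  replace (pos eps) with (exp M * (2 * (eps / 2 / exp M))) by (field; apply Rgt_not_eq, exp_pos).
  apply Rmult_lt_compat_l; [apply exp_pos|].
  apply Rabs_lt_between in H1. apply Rabs_lt_between in H2. apply Rabs_lt_between. lra. }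
specialize (HU (mkposreal _ Hd)). simpl in HU.
destruct Hx as [-> | ->]; destruct HU as [A HA].
- exists A. intros y Hy. apply Q; apply HA; lra.
- exists (A - 1). intros y Hy. apply Q; apply HA; lra.
Qed.

(** The slope is [W 0] times the exponential of the integrated drift, and it tends to [0]. *)
Lemma profile_drift_diverges (fm fp : R -> R) (lo hi M K : R) (U W : R -> R) (x : Rbar) :
  speed_bounds fm fp lo hi M K -> viscous_profile fm fp lo hi U W ->
  W 0 <> 0 -> is_lim W x 0 ->
  is_lim (RInt (fun z => mixed_speed fm fp (U z) (Vlim z)) 0) x m_infty.
Proof.
intros B P H0 HW.
apply is_lim_spec. intros A.
assert (Hd : 0 < Rabs (W 0) * exp A).
{ apply Rmult_lt_0_compat; [now apply Rabs_pos_lt | apply exp_pos]. }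
apply is_lim_spec in HW. generalize (HW (mkposreal _ Hd)).
apply filter_imp. intros y Hy. simpl in Hy.
rewrite Rminus_0_r, (profile_slope_from _ _ _ _ _ _ _ _ 0 y B P), Rabs_mult in Hy.
rewrite (Rabs_pos_eq (exp _)) in Hy by (left; apply exp_pos).
apply Rmult_lt_reg_l in Hy; [|now apply Rabs_pos_lt].
now apply exp_lt_inv.
Qed.

(** The mixed speed differs from [fp'] by [(1 - V) (fm' - fp') / 2], at most [M * gauss] on the
    right half-line, and [gauss] has integral [half_mass] there. *)
Lemma profile_drift_right (fm fp : R -> R) (lo hi M K : R) (U W : R -> R) (y : R) :
  speed_bounds fm fp lo hi M K -> viscous_profile fm fp lo hi U W -> 0 <= y ->
  RInt (fun s => Derive fp (U s)) 0 y
  <= RInt (fun z => mixed_speed fm fp (U z) (Vlim z)) 0 y + M * half_mass.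
Proof.
intros B P Hy.
set (A := fun z => mixed_speed fm fp (U z) (Vlim z)).
set (b := fun s => Derive fp (U s)).
assert (CA : forall z, continuous A z) by (intros; eapply profile_drift_continuous; eassumption).
assert (Cb : forall z, continuous b z).
{ intros z. apply (continuous_comp U (Derive fp)).
  - eapply is_derive_continuous, (vp_slope P).
  - eapply speed_continuous_p, B. }
set (F := fun z => (RInt A 0 z - RInt b 0 z) + M * gauss_area z).
assert (D : forall z, is_derive F z ((A z - b z) + M * gauss z)).
{ intros z. apply (@is_derive_plus R_AbsRing R_NormedModule).
  - apply (@is_derive_minus R_AbsRing R_NormedModule); now apply is_derive_primitive.
  - apply (is_derive_scal gauss_area), is_derive_gauss_area. }
assert (I : F 0 <= F y).
{ apply derive_nonneg_le with (fun z => (A z - b z) + M * gauss z); [assumption|intros; apply D| |].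
  - intros z _. eapply is_derive_continuous, D.
  - intros z Hz. unfold A, b, mixed_speed.
    generalize (sb_max B (U z) (vp_range P z)) (Vlim_tail z (proj1 Hz)) (Vlim_bound z).
    generalize (Derive fm (U z)) (Derive fp (U z)) (Vlim z) (gauss z). intros p q v g Hpq Hg Hv.
    replace (/ 2 * ((1 - v) * p + (1 + v) * q) - q + M * g)
      with (/ 2 * ((1 - v) * (p - q)) + M * g) by field.
    assert (- M <= p - q) by (split_Rabs; lra).
    assert (0 <= M) by (split_Rabs; lra). nra. }
unfold F in I. rewrite !RInt_same, gauss_area_0 in I.
assert (HM : 0 <= M).
{ apply Rle_trans with (2 := sb_max B (U 0) (vp_range P 0)).
  apply Rplus_le_le_0_compat; apply Rabs_pos. }
generalize (Rmult_le_compat_l M _ _ HM (gauss_area_le_half_mass y)). lra.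
Qed.

(** As in [profile_drift_right], with [(1 + V) (fp' - fm') / 2] on the left half-line. *)
Lemma profile_drift_left (fm fp : R -> R) (lo hi M K : R) (U W : R -> R) (y : R) :
  speed_bounds fm fp lo hi M K -> viscous_profile fm fp lo hi U W -> y <= 0 ->
  - RInt (fun z => mixed_speed fm fp (U z) (Vlim z)) 0 y - M * half_mass
  <= RInt (fun s => Derive fm (U s)) y 0.
Proof.
intros B P Hy.
set (A := fun z => mixed_speed fm fp (U z) (Vlim z)).
set (b := fun s => Derive fm (U s)).
assert (CA : forall z, continuous A z) by (intros; eapply profile_drift_continuous; eassumption).
assert (Cb : forall z, continuous b z).
{ intros z. apply (continuous_comp U (Derive fm)).
  - eapply is_derive_continuous, (vp_slope P).
  - eapply speed_continuous_m, B. }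
set (F := fun z => M * gauss_area z - (RInt A 0 z - RInt b 0 z)).
assert (D : forall z, is_derive F z (M * gauss z - (A z - b z))).
{ intros z. apply (@is_derive_minus R_AbsRing R_NormedModule).
  - apply (is_derive_scal gauss_area), is_derive_gauss_area.
  - apply (@is_derive_minus R_AbsRing R_NormedModule); now apply is_derive_primitive. }
assert (I : F y <= F 0).
{ apply derive_nonneg_le with (fun z => M * gauss z - (A z - b z)); [assumption|intros; apply D| |].
  - intros z _. eapply is_derive_continuous, D.
  - intros z Hz. unfold A, b, mixed_speed.
    generalize (sb_max B (U z) (vp_range P z))
      (Vlim_tail (- z) ltac:(lra)) (Vlim_bound z).
    rewrite Vlim_opp, gauss_even.
    generalize (Derive fm (U z)) (Derive fp (U z)) (Vlim z) (gauss z). intros p q v g Hpq Hg Hv.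
    replace (M * g - (/ 2 * ((1 - v) * p + (1 + v) * q) - p))
      with (M * g - / 2 * ((1 + v) * (q - p))) by field.
    assert (q - p <= M) by (split_Rabs; lra).
    assert (0 <= M) by (split_Rabs; lra). nra. }
unfold F in I. rewrite !RInt_same, gauss_area_0 in I.
assert (HM : 0 <= M).
{ apply Rle_trans with (2 := sb_max B (U 0) (vp_range P 0)).
  apply Rplus_le_le_0_compat; apply Rabs_pos. }
generalize (Rmult_le_compat_l M _ _ HM (gauss_area_le_half_mass (- y))) (RInt_rev b y 0 Cb).
rewrite gauss_area_opp. lra.
Qed.

(** * Layers trapped near an attracting state *)

(** While [U] is within [d] of [u0] the slope satisfies [w' <= - c w], so [U + w / c] is
    nonincreasing and [U] can grow by at most [w x / c] more. An end state above [u0 + d] would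
    force [U] to reach the level [u0 + d] first, which this budget forbids. *)
Lemma layer_trapped_right_incr (l r m : R) (a U w : R -> R) (x c d u0 : R) :
  layer l r m a U w -> l <= r -> 0 < c -> - m <= x < m ->
  (forall y, x <= y < m -> Rabs (U y - u0) <= d -> a y <= - c) ->
  Rabs (U x - u0) + Rabs (w x) / c < d -> Rabs (r - u0) <= d.
Proof.
intros L Hlr Hc Hx Ha H0.
generalize (layer_slope_nonneg _ _ _ _ _ _ L Hlr). intros Hw.
generalize (layer_nondecreasing _ _ _ _ _ _ L Hlr). intros Hmon.
rewrite (Rabs_pos_eq (w x)) in H0 by apply Hw.
assert (Hwc : forall y, 0 <= w y / c) by (intros; apply Rdiv_le_0_compat; [apply Hw | assumption]).
assert (HUx : Rabs (U x - u0) < d) by (generalize (Hwc x); lra).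
apply Rabs_lt_between in HUx.
assert (Hr : U m = r) by (apply (layer_right L); lra).
assert (HUm : U x <= U m) by (apply Hmon; lra).
apply Rabs_le_between. split; [lra|].
apply Rnot_lt_le. intros Hout.
destruct (IVT_gen U x m (u0 + d)) as [t [Ht EU]].
- intros y. apply continuity_pt_filterlim, (layer_continuous L).
- rewrite Rmin_left, Rmax_right by assumption. lra.
- rewrite Rmin_left, Rmax_right in Ht by lra.
  assert (Htm : t < m).
  { destruct (Rle_lt_or_eq_dec _ _ (proj2 Ht)) as [H|H]; [assumption|]. rewrite H in EU. lra. }
  assert (G : - U x - w x / c <= - U t - w t / c).
  { apply derive_nonneg_le with (f := fun y => - U y - w y / c) (df := fun y => - w y - a y * w y / c); [lra| | |].
    - intros y Hy.
      apply (@is_derive_minus R_AbsRing R_NormedModule).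
      + apply (is_derive_opp U), (layer_derive L). lra.
      + apply is_derive_ext with (fun z => / c * w z); [intros; apply Rmult_comm|].
        replace (a y * w y / c) with (/ c * (a y * w y)) by (unfold Rdiv; ring).
        apply (is_derive_scal w), (layer_slope_derive _ _ _ _ _ _ _ L).
    - intros y _. apply (@continuous_minus R_UniformSpace R_AbsRing R_NormedModule).
      + apply (@continuous_opp R_UniformSpace R_AbsRing R_NormedModule), (layer_continuous L).
      + apply continuous_ext with (fun z => / c * w z); [intros; apply Rmult_comm|].
        apply (continuous_scal_r (/ c) w).
        eapply is_derive_continuous, (layer_slope_derive _ _ _ _ _ _ _ L).
    - intros y Hy.
      assert (Hay : a y <= - c).
      { apply Ha; [lra|]. apply Rabs_le_between.
        generalize (Hmon x y ltac:(lra)) (Hmon y t ltac:(lra)). lra. }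
      replace (- w y - a y * w y / c) with ((w y / c) * (- c - a y)) by (field; lra).
      apply Rmult_le_pos; [apply Hwc | lra]. }
  generalize (Hwc t) (Rle_abs (U x - u0)). lra.
Qed.

Lemma layer_trapped_right (l r m : R) (a U w : R -> R) (x c d u0 : R) :
  layer l r m a U w -> 0 < c -> - m <= x < m ->
  (forall y, x <= y < m -> Rabs (U y - u0) <= d -> a y <= - c) ->
  Rabs (U x - u0) + Rabs (w x) / c < d -> Rabs (r - u0) <= d.
Proof.
intros L Hc Hx Ha H0.
destruct (Rle_dec l r) as [H|H].
- eapply layer_trapped_right_incr; eassumption.
- replace (Rabs (r - u0)) with (Rabs (- r - - u0)).
  2: { rewrite <- Rabs_Ropp. f_equal. ring. }
  apply (layer_trapped_right_incr _ _ _ _ _ _ x c d (- u0) (layer_neg _ _ _ _ _ _ L)); try assumption.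
  + lra.
  + intros y Hy HU. apply Ha; [assumption|].
    rewrite <- Rabs_Ropp. replace (- (U y - u0)) with (- U y - - u0) by ring. exact HU.
  + rewrite Rabs_Ropp. replace (- U x - - u0) with (- (U x - u0)) by ring. now rewrite Rabs_Ropp.
Qed.

Lemma layer_trapped_left (l r m : R) (a U w : R -> R) (x c d u0 : R) :
  layer l r m a U w -> 0 < c -> - m <= x < m ->
  (forall y, x <= y < m -> Rabs (U (- y) - u0) <= d -> c <= a (- y)) ->
  Rabs (U (- x) - u0) + Rabs (w (- x)) / c < d -> Rabs (l - u0) <= d.
Proof.
intros L Hc Hx Ha H0.
apply (layer_trapped_right _ _ _ _ _ _ x c d u0 (layer_reflect _ _ _ _ _ _ L)); try assumption.
- intros y Hy HU. apply Ropp_le_contravar. now apply Ha.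
- now rewrite Rabs_Ropp.
Qed.

(** Where [V] is close to [1] the mixed speed is close to [fp']. *)
Lemma mixed_speed_near_plus (fm fp : R -> R) (lo hi M K u v p q : R) :
  speed_bounds fm fp lo hi M K -> lo <= u <= hi -> -1 <= v <= 1 ->
  Derive fp u <= - p -> (1 - v) * M <= q -> mixed_speed fm fp u v <= - p + q.
Proof.
intros B Hu Hv. generalize (sb_max B u Hu). unfold mixed_speed.
generalize (Derive fm u) (Derive fp u). intros r s Hm Hs Hq.
replace (/ 2 * ((1 - v) * r + (1 + v) * s)) with (s + / 2 * ((1 - v) * (r - s))) by field.
assert (r - s <= M) by (split_Rabs; lra).
assert (0 <= M) by (split_Rabs; lra). nra.
Qed.

Lemma mixed_speed_near_minus (fm fp : R -> R) (lo hi M K u v p q : R) :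
  speed_bounds fm fp lo hi M K -> lo <= u <= hi -> -1 <= v <= 1 ->
  p <= Derive fm u -> (1 + v) * M <= q -> p - q <= mixed_speed fm fp u v.
Proof.
intros B Hu Hv. generalize (sb_max B u Hu). unfold mixed_speed.
generalize (Derive fm u) (Derive fp u). intros r s Hm Hs Hq.
replace (/ 2 * ((1 - v) * r + (1 + v) * s)) with (r + / 2 * ((1 + v) * (s - r))) by field.
assert (- M <= s - r) by (split_Rabs; lra).
assert (0 <= M) by (split_Rabs; lra). nra.
Qed.

(** Away from a fixed compact set [V] is close to [-1] or [1], so near [u0] the drift has the
    sign that damps slopes outwards, and the extra term [- eps * y] helps on both sides. On the
    compact set the layers are close to [u0] with slopes tending to [0]; they are then trapped
    near [u0] up to their ends. *)
Lemma constant_limit_equal_states (fm fp : R -> R) (uL uR M K u0 : R)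
    (e : nat -> R) (Un Vn wn : nat -> R -> R) :
  speed_bounds fm fp (Rmin uL uR) (Rmax uL uR) M K -> 0 < M -> vanishing e ->
  (forall n, viscous_layer fm fp uL uR M (e n) (Un n) (Vn n) (wn n)) ->
  locally_uniform_limit Un (fun _ => u0) -> locally_uniform_limit wn (fun _ => 0) ->
  Derive fp u0 < 0 -> 0 < Derive fm u0 -> uL = uR.
Proof.
intros B HM He HL HU Hw Hp Hm.
set (k := Rmin (- Derive fp u0) (Derive fm u0)).
assert (Hk : 0 < k) by (apply Rmin_pos; lra).
assert (Hkp : Derive fp u0 <= - k) by (generalize (Rmin_l (- Derive fp u0) (Derive fm u0)); fold k; lra).
assert (Hkm : k <= Derive fm u0) by apply Rmin_r.
generalize (sb_nonneg B). intros HK.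
(* Within this radius, [fm'] and [fp'] move by at most [k / 4] from their values at [u0]. *)
enough (Q : forall d, 0 < d -> d <= k / (4 * (K + 1)) -> Rabs (uL - u0) <= d /\ Rabs (uR - u0) <= d).
{ destruct (Req_dec uL uR) as [E|E]; [assumption|exfalso].
  assert (Hd : 0 < Rabs (uL - uR) / 3).
  { apply Rdiv_lt_0_compat; [apply Rabs_pos_lt|]; lra. }
  assert (Hd2 : 0 < k / (4 * (K + 1))) by (apply Rdiv_lt_0_compat; lra).
  destruct (Q (Rmin (Rabs (uL - uR) / 3) (k / (4 * (K + 1))))) as [Q1 Q2].
  - now apply Rmin_pos.
  - apply Rmin_r.
  - generalize (Rmin_l (Rabs (uL - uR) / 3) (k / (4 * (K + 1)))). intros Hmin.
    split_Rabs; lra. }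
intros d Hd Hdk.
assert (HKd : K * d <= k / 4).
{ apply Rmult_le_compat_l with (r := K + 1) in Hdk; [|lra].
  replace ((K + 1) * (k / (4 * (K + 1)))) with (k / 4) in Hdk by (field; lra). lra. }
assert (Np : forall u, Rabs (u - u0) <= d -> Derive fp u <= - (3 * k / 4)).
{ intros u Hu. generalize (sb_lip_p B u u0) (Rmult_le_compat_l K _ _ HK Hu).
  intros H1 H2. apply Rabs_le_between in H1. lra. }
assert (Nm : forall u, Rabs (u - u0) <= d -> 3 * k / 4 <= Derive fm u).
{ intros u Hu. generalize (sb_lip_m B u u0) (Rmult_le_compat_l K _ _ HK Hu).
  intros H1 H2. apply Rabs_le_between in H1. lra. }
assert (Hg : 0 < k / (8 * M)) by (apply Rdiv_lt_0_compat; lra).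
destruct (gauss_small 1 _ Rlt_0_1 Hg) as [e0 [He0 Hsmall]].
(* Beyond [x], and for large [n], [V] is within [k / (4 * M)] of its limit, which leaves the
   mixed speed at least [k / 2] away from zero. *)
set (x := 1 / (e0 / 2)).
assert (Hx : 0 < x) by (apply Rdiv_lt_0_compat; lra).
assert (HVx : forall y, x <= y -> 1 - Vlim y <= k / (8 * M)).
{ intros y Hy. apply Rle_trans with (1 - Vlim x).
  - destruct Hy as [Hy | ->]; [generalize (Vlim_increasing x y Hy)|]; lra.
  - apply Rle_trans with (gauss x); [apply Vlim_tail; lra|]. left. apply Hsmall. lra. }
assert (Hd3 : 0 < d / 3) by lra.
assert (Hd4 : 0 < d / 3 * (k / 2)) by (apply Rmult_lt_0_compat; lra).
destruct (@filter_and nat eventually _ _ _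
  (@filter_and nat eventually _ _ _ (HU (x + 1) (d / 3) ltac:(lra) Hd3)
                                    (Hw (x + 1) (d / 3 * (k / 2)) ltac:(lra) Hd4))
  (@filter_and nat eventually _ _ _ (eventually_width M (x + 1) e HM ltac:(lra) He)
                                    (gaussian_layers_uniform _ _ _ _ _ _ _ _ _ _ HM Hg He HL))) as [n Hn].
destruct (Hn n (Nat.le_refl n)) as [[HUn Hwn] [Hmn HVn]].
assert (Start : forall y, - (x + 1) < y < x + 1 -> Rabs (Un n y - u0) + Rabs (wn n y) / (k / 2) < d).
{ intros y Hy. specialize (HUn y Hy). specialize (Hwn y Hy). rewrite Rminus_0_r in Hwn.
  assert (Rabs (wn n y) / (k / 2) <= d / 3); [|lra].
  apply Rmult_le_reg_r with (k / 2); [lra|].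
  replace (Rabs (wn n y) / (k / 2) * (k / 2)) with (Rabs (wn n y)) by (field; lra). exact Hwn. }
generalize (vl_eps (HL n)). intros Hen.
assert (HqM : k / (8 * M) * M = k / 8) by (field; lra).
split.
- apply (layer_trapped_left _ _ _ _ _ _ x (k / 2) d u0 (vl_U (HL n))); [lra|lra| |].
  + intros y Hy Hclose.
    destruct (viscous_layer_range _ _ _ _ _ _ _ _ _ (- y) (HL n)) as [R1 R2].
    assert (HV : (1 + Vn n (- y)) * M <= k / 4).
    { generalize (HVx y (proj1 Hy)) (HVn (- y)). rewrite Vlim_opp. intros H1 H2.
      apply Rabs_le_between in H2.
      apply Rle_trans with (2 * (k / (8 * M)) * M); [|lra].
      apply Rmult_le_compat_r; lra. }
    generalize (mixed_speed_near_minus _ _ _ _ _ _ _ _ _ _ B R1 R2 (Nm _ Hclose) HV).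
    assert (0 <= e n * y) by (apply Rmult_le_pos; lra). lra.
  + apply Start. lra.
- apply (layer_trapped_right _ _ _ _ _ _ x (k / 2) d u0 (vl_U (HL n))); [lra|lra| |].
  + intros y Hy Hclose.
    destruct (viscous_layer_range _ _ _ _ _ _ _ _ _ y (HL n)) as [R1 R2].
    assert (HV : (1 - Vn n y) * M <= k / 4).
    { generalize (HVx y (proj1 Hy)) (HVn y). intros H1 H2.
      apply Rabs_le_between in H2.
      apply Rle_trans with (2 * (k / (8 * M)) * M); [|lra].
      apply Rmult_le_compat_r; lra. }
    generalize (mixed_speed_near_plus _ _ _ _ _ _ _ _ _ _ B R1 R2 (Np _ Hclose) HV).
    assert (0 <= e n * y) by (apply Rmult_le_pos; lra). lra.
  + apply Start. lra.
Qed.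

(** * Convergence of the rescaled solutions *)

Lemma rescaled_v_error (fm fp : R -> R) (uL uR M eps : R) (u v : R -> R) (y : R) :
  0 < M -> 0 < eps -> is_viscous_solution fm fp uL uR M eps u v ->
  Rabs (rescaled M (-1) 1 eps v y - Vlim y) <= gauss (M / eps).
Proof.
intros HM He S. eapply gaussian_layer_error, solution_v_layer; eassumption.
Qed.

Lemma solution_layers (fm fp : R -> R) (uL uR M K : R) (u v : R -> R -> R) (e : nat -> R) :
  speed_bounds fm fp (Rmin uL uR) (Rmax uL uR) M K -> 0 < M -> vanishing e ->
  (forall eps, 0 < eps -> is_viscous_solution fm fp uL uR M eps (u eps) (v eps)) ->
  exists wn : nat -> R -> R, forall n, viscous_layer fm fp uL uR M (e n)
    (rescaled M uL uR (e n) (u (e n))) (rescaled M (-1) 1 (e n) (v (e n))) (wn n).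
Proof.
intros B HM [He _] S.
assert (X : forall n, exists w, viscous_layer fm fp uL uR M (e n)
    (rescaled M uL uR (e n) (u (e n))) (rescaled M (-1) 1 (e n) (v (e n))) w).
{ intros n. apply (solution_viscous_layer _ _ _ _ _ _ _ _ _ B HM (He n)), S, He. }
exists (fun n => proj1_sig (constructive_indefinite_description _ (X n))).
intros n. apply proj2_sig.
Qed.

Lemma profile_limits (fm fp : R -> R) (uL uR : R) (U W : R -> R) :
  viscous_profile fm fp (Rmin uL uR) (Rmax uL uR) U W ->
  (uL <= uR -> nondecreasing U) -> (uR <= uL -> nonincreasing U) ->
  exists lm lp : R, is_lim U m_infty lm /\ is_lim U p_infty lp /\
    Rmin uL uR <= lm <= Rmax uL uR /\ Rmin uL uR <= lp <= Rmax uL uR.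
Proof.
intros P Hi Hd. apply monotone_limits; [|apply (vp_range P)].
destruct (Rle_dec uL uR); [left | right]; auto. apply Hd. lra.
Qed.

(** A subsequence converges locally uniformly to a profile, which is the given [L1loc_lim] limit by
    uniqueness of continuous limits; thus every limit inherits the properties of profiles. *)
Lemma inner_limit_is_profile (fm fp : R -> R) (uL uR M K : R) (e : nat -> R)
    (Un Vn wn : nat -> R -> R) (U : R -> R) :
  speed_bounds fm fp (Rmin uL uR) (Rmax uL uR) M K -> 0 < M -> vanishing e ->
  (forall n, viscous_layer fm fp uL uR M (e n) (Un n) (Vn n) (wn n)) ->
  (forall y, continuous U y) -> L1loc_lim Un U ->
  exists (phi : nat -> nat) (W : R -> R), extraction phi /\
    locally_uniform_limit (fun n => Un (phi n)) U /\
    locally_uniform_limit (fun n => wn (phi n)) W /\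
    viscous_profile fm fp (Rmin uL uR) (Rmax uL uR) U W /\
    (uL <= uR -> nondecreasing U) /\ (uR <= uL -> nonincreasing U).
Proof.
intros B HM He HL HU HLim.
destruct (viscous_layers_compact _ _ _ _ _ _ _ _ _ _ B HM He HL)
  as [phi [U' [W [Hphi [LU [LW [P Mon]]]]]]].
assert (CU' : forall y, continuous U' y)
  by (intros; eapply is_derive_continuous, (vp_slope P)).
assert (CUn : forall n y, continuous (Un n) y)
  by (intros n y; apply (layer_continuous (vl_U (HL n)))).
assert (E : U = U').
{ apply functional_extensionality.
  apply (L1loc_lim_unique (fun n => Un (phi n))); try assumption.
  - intros n y. apply CUn.
  - now apply L1loc_lim_extraction.
  - apply locally_uniform_L1loc; auto. }
rewrite E. exists phi, W. auto.
Qed.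

Lemma gauss_speed (M eps : R) : 0 < eps -> gauss (M / eps) = exp (- (M ^ 2 / (2 * eps ^ 2))).
Proof. intros He. unfold gauss. f_equal. field. lra. Qed.

Lemma nontrivial_profile_conditions (fm fp : R -> R) (lo hi M K lm lp : R) (U W : R -> R) :
  speed_bounds fm fp lo hi M K -> viscous_profile fm fp lo hi U W ->
  is_lim U m_infty lm -> is_lim U p_infty lp -> W 0 <> 0 ->
  is_lim (fun y => RInt (fun s => Derive fp (U s)) 0 y) p_infty m_infty /\
  is_lim (fun y => RInt (fun s => Derive fm (U s)) y 0) m_infty p_infty.
Proof.
intros B P Hm Hp H0.
assert (Dp := profile_drift_diverges _ _ _ _ _ _ _ _ p_infty B P H0
  (profile_slope_limit _ _ _ _ _ _ _ _ _ _ B P (or_introl eq_refl) Hp)).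
assert (Dm := profile_drift_diverges _ _ _ _ _ _ _ _ m_infty B P H0
  (profile_slope_limit _ _ _ _ _ _ _ _ _ _ B P (or_intror eq_refl) Hm)).
apply is_lim_spec in Dp. apply is_lim_spec in Dm.
split; apply is_lim_spec; intros A.
- destruct (Dp (A - M * half_mass)) as [z Hz]. exists (Rmax 0 z). intros y Hy.
  generalize (Rmax_l 0 z) (Rmax_r 0 z). intros.
  generalize (Hz y ltac:(lra)) (profile_drift_right _ _ _ _ _ _ _ _ y B P ltac:(lra)). lra.
- destruct (Dm (- A - M * half_mass)) as [z Hz]. exists (Rmin 0 z). intros y Hy.
  generalize (Rmin_l 0 z) (Rmin_r 0 z). intros.
  generalize (Hz y ltac:(lra)) (profile_drift_left _ _ _ _ _ _ _ _ y B P ltac:(lra)). lra.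
Qed.

Lemma negative_of_integral_limit (c : R) :
  is_lim (fun y => RInt (fun _ => c) 0 y) p_infty m_infty -> c < 0.
Proof.
intros H. apply is_lim_spec in H. destruct (H 0) as [A HA].
generalize (HA (Rmax 0 A + 1) ltac:(generalize (Rmax_r 0 A); lra)) (Rmax_l 0 A).
rewrite RInt_const. change (scal ?x ?y) with (x * y). intros. nra.
Qed.

Lemma positive_of_integral_limit (c : R) :
  is_lim (fun y => RInt (fun _ => c) y 0) m_infty p_infty -> 0 < c.
Proof.
intros H. apply is_lim_spec in H. destruct (H 0) as [A HA].
generalize (HA (Rmin 0 A - 1) ltac:(generalize (Rmin_r 0 A); lra)) (Rmin_l 0 A).
rewrite RInt_const. change (scal ?x ?y) with (x * y). intros. nra.
Qed.

Theorem theorem3p1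
  (fm fp : R -> R) (Hfm : flux fm) (Hfp : flux fp)
  (uL uR M : R) (HM : is_max_speed fm fp uL uR M) (HM0 : 0 < M)
  (u v : R -> R -> R)
  (Hsol : forall eps : R, 0 < eps ->
     is_viscous_solution fm fp uL uR M eps (u eps) (v eps)) :
  (bounded_fun Vlim /\ strictly_increasing Vlim /\ (forall k : nat, Ck k Vlim) /\
   (forall d : R, 0 < d ->
      at_right 0 (fun eps => forall y : R,
        Rabs (rescaled M (-1) 1 eps (v eps) y - Vlim y) < d)) /\
   (exists C : R, 0 < C /\ forall eps : R, 0 < eps -> forall y : R,
      Rabs (rescaled M (-1) 1 eps (v eps) y - Vlim y)
      <= C * exp (- (M ^ 2 / (2 * eps ^ 2)))))
  /\
  (forall e : nat -> R, vanishing e ->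
   exists (phi : nat -> nat) (U : R -> R),
     extraction phi /\
     L1loc_lim (fun n => rescaled M uL uR (e (phi n)) (u (e (phi n)))) U /\
     bounded_fun U /\ Ck 2 U /\
     (uL <= uR -> nondecreasing U) /\ (uR <= uL -> nonincreasing U) /\
     (forall y : R,
        / 2 * ((1 - Vlim y) * Derive fm (U y) + (1 + Vlim y) * Derive fp (U y))
            * Derive U y
        = Derive_n U 2 y) /\
     (exists Uminf Upinf : R,
        is_lim U m_infty Uminf /\ is_lim U p_infty Upinf /\
        Rmin uL uR <= Uminf <= Rmax uL uR /\
        Rmin uL uR <= Upinf <= Rmax uL uR))
  /\
  (forall (e : nat -> R) (U : R -> R), vanishing e -> Ck 2 U ->
   L1loc_lim (fun n => rescaled M uL uR (e n) (u (e n))) U ->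
     (uL <> uR ->
        ((forall y : R, Derive U y <> 0) <->
         (is_lim (fun y => RInt (fun s => Derive fp (U s)) 0 y) p_infty m_infty /\
          is_lim (fun y => RInt (fun s => Derive fm (U s)) y 0) m_infty p_infty)))
     /\
     ((forall y : R, Derive U y <> 0) ->
        is_lim (Derive U) p_infty 0 /\ is_lim (Derive U) m_infty 0)).
Proof.
destruct (flux_speed_bounds fm fp uL uR M Hfm Hfp HM) as [K B].
split; [|split].
- split; [|split; [|split; [|split]]].
  + exists 1. intros y. apply Rabs_le_between, Vlim_bound.
  + exact Vlim_increasing.
  + exact Vlim_smooth.
  + intros d Hd. destruct (gauss_small M d HM0 Hd) as [e0 [He0 Hg]].
    exists (mkposreal e0 He0). intros eps Hball Heps y.
    change (Rabs (eps - 0) < e0) in Hball. rewrite Rminus_0_r, Rabs_pos_eq in Hball by lra.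
    eapply Rle_lt_trans; [eapply rescaled_v_error; eauto | apply Hg; lra].
  + exists 1. split; [lra|]. intros eps Heps y.
    rewrite Rmult_1_l, <- gauss_speed by assumption. eapply rescaled_v_error; eauto.
- intros e He.
  destruct (solution_layers _ _ _ _ _ _ _ _ _ B HM0 He Hsol) as [wn HL].
  destruct (viscous_layers_compact _ _ _ _ _ _ _ _ _ _ B HM0 He HL)
    as [phi [U [W [Hphi [LU [LW [P [Hi Hd]]]]]]]].
  destruct (profile_C2 _ _ _ _ _ _ _ _ B P) as [C2 [E1 E2]].
  exists phi, U. split; [assumption|split; [|split; [|split; [assumption|split; [assumption|split; [assumption|split]]]]]].
  + apply (locally_uniform_L1loc (fun n => rescaled M uL uR (e (phi n)) (u (e (phi n))))); try assumption.
    * intros n y. apply (layer_continuous (vl_U (HL (phi n)))).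
    * intros y. eapply is_derive_continuous, (vp_slope P).
  + exists (Rabs (Rmin uL uR) + Rabs (Rmax uL uR)). intros y.
    generalize (vp_range P y). intros. apply Rabs_le_between. split_Rabs; lra.
  + intros y. rewrite E1, E2. reflexivity.
  + eapply profile_limits; eassumption.
- intros e U He HC2 HLim.
  destruct (solution_layers _ _ _ _ _ _ _ _ _ B HM0 He Hsol) as [wn HL].
  assert (CU : forall y, continuous U y) by (intros y; apply (HC2 0%nat y); lia).
  destruct (inner_limit_is_profile _ _ _ _ _ _ _ _ _ _ _ B HM0 He HL CU HLim)
    as [phi [W [Hphi [LU [LW [P [Hi Hd]]]]]]].
  destruct (profile_C2 _ _ _ _ _ _ _ _ B P) as [_ [E1 _]].
  destruct (profile_limits _ _ _ _ _ _ P Hi Hd) as [lm [lp [Lm [Lp _]]]].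
  split.
  + intros Hne. split.
    * intros Hnz. apply (nontrivial_profile_conditions _ _ _ _ _ _ _ _ _ _ B P Lm Lp).
      rewrite <- E1. apply Hnz.
    * intros [Cp Cm] y Hy. apply Hne.
      assert (W0 : forall z, W z = 0).
      { intros z. rewrite (profile_slope_from _ _ _ _ _ _ _ _ y z B P), <- E1, Hy. ring. }
      assert (EW : W = fun _ => 0) by (apply functional_extensionality, W0).
      assert (EU : U = fun _ => U 0).
      { apply functional_extensionality. intros z.
        apply (derive_zero_eq U (- Rabs z - 1) (Rabs z + 1)).
        - intros t _. rewrite <- (W0 t). apply (vp_slope P).
        - generalize (Rle_abs z) (Rle_abs (- z)). rewrite Rabs_Ropp. lra.
        - generalize (Rabs_pos z). lra. }
      rewrite EW in LW. revert LU Cp Cm. rewrite EU. intros LU Cp Cm.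
      apply (constant_limit_equal_states fm fp uL uR M K (U 0) (fun n => e (phi n))
        (fun n => rescaled M uL uR (e (phi n)) (u (e (phi n))))
        (fun n => rescaled M (-1) 1 (e (phi n)) (v (e (phi n))))
        (fun n => wn (phi n))); try assumption.
      -- now apply vanishing_extraction.
      -- intros n. apply HL.
      -- now apply negative_of_integral_limit.
      -- now apply positive_of_integral_limit.
  + intros _. replace (Derive U) with W by (apply functional_extensionality; intros; now rewrite E1).
    split; eapply profile_slope_limit; eauto.
Qed.
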